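(* Assume $mn\ge2$ and $K\ge1$. Let $H\in\mathbb S_{++}^{mn}$, $G\in\mathcal K_{m,n}$, and let $\rho=d_{\mathrm{AI}}(H,G)$, $\eta=\|\Pi_{\mathcal L}\log(G^{-1/2}HG^{-1/2})\|_F$, $\kappa_G=\kappa(G^{-1}H)$ and $\alpha_{mn}=\sqrt{mn/\lfloor(mn)^2/4\rfloor}$. Suppose real numbers satisfy the validated enclosures $$0\le\underline\rho\le\rho,\qquad 0\le\eta\le\overline\eta,\qquad 1\le\underline\kappa\le\kappa_G\le\overline\kappa,$$ and set $\underline\delta=\sqrt{\max\{\underline\rho^2-\overline\eta^2,0\}}$. Then $$\begin{array}{rcl} \exp(\alpha_{mn}\underline\delta)>K&\Longrightarrow&\mathcal R_{K,\mathcal K}(H)=\emptyset,\\ \overline\kappa\le K&\Longrightarrow&G\in\mathcal R_{K,\mathcal K}(H),\\ e^{2\overline\eta}\,\overline\kappa\le K&\Longrightarrow&P_{\mathcal K}(H)\in\mathcal R_{K,\mathcal K}(H),\\ e^{-2\overline\eta}\,\underline\kappa>K&\Longrightarrow&P_{\mathcal K}(H)\notin\mathcal R_{K,\mathcal K}(H). \end{array}$$ Consequently, if the exponentials, products and final comparisons in these four tests are evaluated with outward rounding (equivalently, as validated log-domain comparisons), so that a test reports success only if the corresponding exact inequality holds, then each of the four finite-precision tests is sound: whenever it reports success, the corresponding right-hand conclusion is true. If no test fires, the procedure returns INCONCLUSIVE.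
   Context: $\mathbb S^d$ denotes real symmetric $d\times d$ matrices and $\mathbb S_{++}^d$ the positive-definite ones. $d_{\mathrm{AI}}(G_0,G_1)=\|\log(G_0^{-1/2}G_1G_0^{-1/2})\|_F$ is the affine-invariant distance. $\kappa(G^{-1}H)$ is the ratio of the largest to the smallest generalized eigenvalue in $Hv=\lambda Gv$. The Kronecker family is $\mathcal K_{m,n}=\{B\otimes A: A\in\mathbb S_{++}^m,\ B\in\mathbb S_{++}^n\}\subset\mathbb S_{++}^{mn}$. For every $M\in\mathbb S_{++}^{mn}$ there is a unique point $P_{\mathcal K}(M)=\operatorname*{arg\,min}_{G\in\mathcal K_{m,n}}d_{\mathrm{AI}}(M,G)$. $\Pi_{\mathcal L}$ is the Frobenius-orthogonal projection of $\mathbb S^{mn}$ onto $\mathcal L_{m,n}=\{I_n\otimes X+Y\otimes I_m: X\in\mathbb S^m,\ Y\in\mathbb S^n\}$. The target set is $\mathcal R_{K,\mathcal K}(H)=\{G\in\mathcal K_{m,n}:\kappa(G^{-1}H)\le K\}$. INCONCLUSIVE is an output that asserts nothing. *)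

(* Defs.v *)
From mathcomp Require Export all_boot all_order all_algebra sesquilinear.
From mathcomp Require Export mxtens.
From mathcomp Require Export all_classical all_reals all_analysis.

Set Implicit Arguments.
Unset Strict Implicit.
Unset Printing Implicit Defensive.

Import Order.TTheory GRing.Theory Num.Theory.

Local Open Scope classical_set_scope.
Local Open Scope ring_scope.

Section Matrices.
Context {R : realType} {N : nat}.
Implicit Types S G H : 'M[R]_N.

Definition spd S : Prop :=
  S \is symmetricmx /\ forall v : 'cV[R]_N, v != 0 -> 0 < (v^T *m S *m v) 0 0.

(* The norm notation `|A| on matrices is the sup norm of the entries, hence
   the explicit Frobenius inner product and norm. *)
Definition frob_dot (A B : 'M[R]_N) : R := \tr (A^T *m B).
Definition frob (A : 'M[R]_N) : R := Num.sqrt (frob_dot A A).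

(* Functional calculus on symmetric matrices: f acts on the eigenvalues of an
   orthogonal diagonalization S = Q^T diag(d) Q.  The value does not depend on
   the diagonalization selected; it is meaningful only for symmetric S. *)
Definition orth_diag S : set ('M[R]_N * 'rV[R]_N) :=
  [set p | p.1 *m p.1^T = 1%:M /\ S = p.1^T *m diag_mx p.2 *m p.1].

Definition mxfun (f : R -> R) S : 'M[R]_N :=
  let p := xget (1%:M, 0) (orth_diag S) in
  p.1^T *m diag_mx (map_mx f p.2) *m p.1.

Definition mxlog S := mxfun (@ln R) S.
Definition mxsqrtV S := mxfun (fun x : R => (Num.sqrt x)^-1) S.

(* G^(-1/2) H G^(-1/2) *)
Definition whiten G H : 'M[R]_N := mxsqrtV G *m H *m mxsqrtV G.

Definition dAI G H : R := frob (mxlog (whiten G H)).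

Definition gen_eigenvalues G H : set R :=
  [set l | exists2 v : 'cV[R]_N, v != 0 & H *m v = l *: (G *m v)].

(* kappa (G^-1 H); the set of generalized eigenvalues is finite, so that its
   supremum and infimum are attained. *)
Definition gen_cond G H : R :=
  sup (gen_eigenvalues G H) / inf (gen_eigenvalues G H).

End Matrices.

Section Kronecker.
Context {R : realType}.
Context {m n : nat}.

Definition kron_family : set 'M[R]_(n * m) :=
  [set G | exists (A : 'M[R]_m) (B : 'M[R]_n), [/\ spd A, spd B & G = B *t A]].

(* Arg min of the affine-invariant distance to H; 0 is a junk value, outside
   the family, that would be returned if there were no minimizer. *)
Definition kron_proj (H : 'M[R]_(n * m)) : 'M[R]_(n * m) :=
  xget 0 [set P | kron_family P /\
                  forall G, kron_family G -> dAI H P <= dAI H G].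

Definition kron_tangent : set 'M[R]_(n * m) :=
  [set Z | exists (X : 'M[R]_m) (Y : 'M[R]_n),
     [/\ X \is symmetricmx, Y \is symmetricmx & Z = 1%:M *t X + Y *t 1%:M]].

Definition tangent_proj (S : 'M[R]_(n * m)) : 'M[R]_(n * m) :=
  xget 0 [set P | kron_tangent P /\
                  forall Z, kron_tangent Z -> frob_dot (S - P) Z = 0].

Definition kron_target (K : R) (H : 'M[R]_(n * m)) : set 'M[R]_(n * m) :=
  [set G | kron_family G /\ gen_cond G H <= K].

Inductive test := Infeasible | PointIn | ProjIn | ProjOut.

Definition exact_test (K alpha delta eta_hi kappa_lo kappa_hi : R) (t : test)
    : bool :=
  match t with
  | Infeasible => K < expR (alpha * delta)
  | PointIn => kappa_hi <= K
  | ProjIn => expR (2 * eta_hi) * kappa_hi <= K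
  | ProjOut => K < expR (- (2 * eta_hi)) * kappa_lo
  end.

Definition log_test (K alpha delta eta_hi kappa_lo kappa_hi : R) (t : test)
    : bool :=
  match t with
  | Infeasible => ln K < alpha * delta
  | PointIn => ln kappa_hi <= ln K
  | ProjIn => 2 * eta_hi + ln kappa_hi <= ln K
  | ProjOut => ln K < - (2 * eta_hi) + ln kappa_lo
  end.

Definition claim (K : R) (H G : 'M[R]_(n * m)) (t : test) : Prop :=
  match t with
  | Infeasible => kron_target K H = set0
  | PointIn => kron_target K H G
  | ProjIn => kron_target K H (kron_proj H)
  | ProjOut => ~ kron_target K H (kron_proj H)
  end.

End Kronecker.

Arguments kron_family {R} m n _.
Arguments kron_tangent {R} m n _.

Inductive output := Fired of (test -> bool) | INCONCLUSIVE.

Definition procedure (reports : test -> bool) : output :=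
  if [|| reports Infeasible, reports PointIn, reports ProjIn | reports ProjOut]
  then Fired reports else INCONCLUSIVE.

Definition output_claim (R : realType) (m n : nat) (K : R)
    (H G : 'M[R]_(n * m)) (o : output) : Prop :=
  match o with
  | Fired reports => forall t, reports t -> claim K H G t
  | INCONCLUSIVE => True
  end.

(* Main.v *)
Require Import Defs.
From mathcomp Require spectral.
From mathcomp Require Import complex.
From mathcomp Require Import ring lra.
Set Implicit Arguments.
Unset Strict Implicit.
Unset Printing Implicit Defensive.
Import Order.TTheory GRing.Theory Num.Theory numFieldNormedType.Exports.
Local Open Scope classical_set_scope.
Local Open Scope ring_scope.

(** Write d for the affine-invariant distance, Log_G H for the logarithm of
    G^(-1/2) H G^(-1/2), and P for the point of the Kronecker family closest to
    H.  Three facts carry the theorem.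

    Strong convexity.  The exponential map does not decrease distances:
    |log A - log B| <= d(A, B) in the Frobenius norm
    ([exponential_metric_increasing]).  Whitening at G, which preserves d, turns
    this into the comparison law of cosines of nonpositive curvature,
    d(G, H)^2 + d(G, G')^2 - 2 <Log_G H, Log_G G'> <= d(G', H)^2
    ([law_of_cosines]).  For G and G' in the Kronecker family, Log_G G' lies in
    the tangent space L, so the inner product is at most eta d(G, G').
    Completing the square gives d(G', H)^2 >= rho^2 - eta^2 for every G' in the
    family ([dAI_family_ge]).  The family contains its geodesics, so the
    minimality of P yields the Pythagorean inequality
    d(H, P)^2 + d(P, G)^2 <= d(H, G)^2 ([pythagoras]); adding it to the law of
    cosines leaves d(G, P) <= eta ([dAI_kron_proj_le]).

    Spread.  N real numbers of mean 0 lying in an interval of length r have a sum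
    of squares of at most r^2 floor(N^2/4) / N, the extreme case being half of
    them at each end.  Rescaling G' so that the logarithms of the generalized
    eigenvalues of (G', H) have mean 0 keeps it in the family, and therefore
    log kappa(G'^-1 H) >= alpha d(cG', H) for a suitable c > 0.  With the lower
    bound on distances this is the infeasibility test ([gen_cond_ge_dist]).

    Stability.  Replacing G by P changes each quadratic form v^T G v by a factor
    in [e^-eta, e^eta], so the condition number changes by a factor of at most
    e^(2 eta) ([gen_cond_le]); the last two tests follow.

    The metric inequality is obtained without differentiating matrix functions.
    In eigenbases of A and B, both |log A - log B|^2 and
    J(A, B) = tr(A^-1 B) + tr(B^-1 A) - 2N are sums over pairs of eigenvalues
    with the same nonnegative weights, of x^2 and of 2 (cosh x - 1) >= x^2, where
    x is the difference of the logarithms.  Hence |log A - log B|^2 <= J(A, B).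
    On a short geodesic step J is almost the squared length, and the triangle
    inequality along n equal steps gives the claim as n grows.

    The nearest point P exists because d(H, exp Z) is continuous and coercive in
    Z in L; coercivity is again the metric inequality. *)

(** * Spectral theorem for real symmetric matrices *)

Lemma symmetricmxP (R : realType) (n : nat) (S : 'M[R]_n) :
  S \is symmetricmx <-> S^T = S.
Proof.
split=> [/is_hermitianmxP|eS]; first by rewrite expr0 scale1r map_mx_id.
by apply/is_hermitianmxP; rewrite expr0 scale1r map_mx_id.
Qed.

Lemma sqnorm_gt0 (R : realType) (n : nat) (u : 'rV[R]_n) :
  u != 0 -> 0 < (u *m u^T) 0 0.
Proof.
move=> u0; rewrite mxE lt_neqAle; apply/andP; split; last first.
  by apply: sumr_ge0 => i _; rewrite mxE -expr2 sqr_ge0.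
apply: contra u0 => /eqP/esym/psumr_eq0P u0.
apply/eqP/matrixP=> i j; rewrite ord1 [RHS]mxE.
have /eqP := u0 (fun k _ => ltac:(by rewrite mxE -expr2 sqr_ge0)) j isT.
by rewrite mxE mulf_eq0 orbb => /eqP.
Qed.

(** Over the complex numbers a real symmetric matrix is Hermitian, so its
    eigenvalues are real; such an eigenvalue is a root of the real
    characteristic polynomial and thus has a real eigenvector. *)
Lemma symmetric_eigenvector (R : realType) (n : nat) (S : 'M[R]_n.+1) :
  S^T = S -> exists (x : R) (u : 'rV[R]_n.+1), u *m u^T = 1%:M /\ u *m S = x *: u.
Proof.
move=> symS.
pose C : numClosedFieldType := R[i]%C.
pose f : {rmorphism R -> C} := real_complex R.
have realf (x : R) : f x \is Num.real by rewrite complex_real.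
pose A := map_mx f S.
have hA : A \is hermsymmx.
  apply: spectral.realsym_hermsym.
    apply/is_hermitianmxP; rewrite expr0 scale1r map_mx_id //.
    by apply/matrixP=> i j; rewrite !mxE -[in LHS]symS mxE.
  by apply/mxOverP=> i j; rewrite mxE.
have /spectral.hermitian_normalmx/spectral.orthomx_spectralP Aeq := hA.
have /mxOverP dreal := spectral.hermitian_spectral_diag_real hA.
set P := spectral.spectralmx A in Aeq; set d := spectral.spectral_diag A in Aeq dreal.
have Pu : P \in unitmx by exact: spectral.spectral_unit.
have /complex_realP[x dx] := dreal 0 0.
have : eigenvalue A (f x).
  apply/eigenvalueP; exists (row 0 P); last first.
    apply: contraTneq Pu => P0; rewrite -row_free_unit -kermx_eq0.
    apply/rowV0Pn; exists (delta_mx 0 0); first by apply/sub_kermxP; rewrite -rowE.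
    by apply/eqP => /matrixP/(_ 0 0)/eqP; rewrite !mxE !eqxx oner_eq0.
  rewrite -row_mul {1}Aeq !mulmxA mulmxV // mul1mx mul_diag_mx.
  by apply/rowP=> j; rewrite !mxE dx.
rewrite eigenvalue_root_char -map_char_poly fmorph_root -eigenvalue_root_char.
case/eigenvalueP=> v vS v0.
have v_gt0 := sqnorm_gt0 v0.
exists x, ((Num.sqrt ((v *m v^T) 0 0))^-1 *: v); split; last first.
  by rewrite -scalemxAl vS !scalerA mulrC.
rewrite linearZ /= -scalemxAr -scalemxAl scalerA -expr2 exprVn sqr_sqrtr ?ltW //.
by rewrite {2}[v *m v^T]mx11_scalar scale_scalar_mx mulVf ?gt_eqF.
Qed.

(** The reflection exchanging the first basis vector and u, which supplies the
    orthogonal change of basis of the induction step below. *)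
Lemma householder (R : realType) (n : nat) (u : 'rV[R]_n.+1) :
  u *m u^T = 1%:M -> exists P : 'M[R]_n.+1, P *m P^T = 1%:M /\ row 0 P = u.
Proof.
move=> u1; pose e : 'rV[R]_n.+1 := delta_mx 0 0.
have e1 : e *m e^T = 1%:M.
  by rewrite trmx_delta mul_delta_mx; apply/matrixP=> i j; rewrite !ord1 !mxE !eqxx.
have [->|ue] := eqVneq u e.
  by exists 1%:M; rewrite trmx1 mulmx1 row1.
have [w [w0 wE]] : exists w, w != 0 /\ w = e - u.
  by exists (e - u); rewrite subr_eq0 eq_sym.
pose c := (w *m w^T) 0 0; have c0 : 0 < c := sqnorm_gt0 w0.
have wc : w *m w^T = c%:M by rewrite [LHS]mx11_scalar.
pose P := 1%:M - (2 / c) *: (w^T *m w).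
have PT : P^T = P by rewrite /P linearB linearZ /= trmx1 trmx_mul trmxK.
have ww : (w^T *m w) *m (w^T *m w) = c *: (w^T *m w).
  by rewrite mulmxA -[w^T *m w *m w^T]mulmxA wc mul_mx_scalar scalemxAl.
exists P; split.
  rewrite PT /P mulmxBl mul1mx mulmxBr mulmx1 -scalemxAl -scalemxAr ww !scalerA.
  rewrite -addrA -opprD -[RHS]subr0; congr (_ - _).
  apply/eqP; rewrite -!scalerBl -scalerDl scaler_eq0.
  by apply/orP; left; apply/eqP; field; rewrite gt_eqF.
rewrite rowE -/e /P mulmxBr mulmx1 -scalemxAr mulmxA.
have ewe : e *m w^T = (c / 2)%:M.
  have eu : e *m u^T = u *m e^T.
    apply/matrixP=> i j; rewrite !ord1 [LHS]mxE [RHS]mxE.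
    by apply: eq_bigr => k _; rewrite [e^T _ _]mxE [u^T _ _]mxE mulrC.
  rewrite [c / 2]mulrC -scale_scalar_mx -wc wE linearB /= !mulmxBl !mulmxBr e1 u1 eu.
  by apply/matrixP=> i j; rewrite !mxE; field.
rewrite ewe mul_scalar_mx scalerA.
have -> : 2 / c * (c / 2) = 1 by field; rewrite gt_eqF.
by rewrite scale1r wE subKr.
Qed.

(** Induction on the dimension: in an orthonormal basis starting with a unit
    eigenvector, symmetry makes the matrix block diagonal. *)
Theorem spectral_theorem (R : realType) (n : nat) (S : 'M[R]_n) :
  S^T = S ->
  exists (Q : 'M[R]_n) (d : 'rV[R]_n), Q *m Q^T = 1%:M /\ S = Q^T *m diag_mx d *m Q.
Proof.
elim: n S => [|n IHn] S symS.
  by exists 1%:M, 0; split; apply/matrixP=> -[].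
have [x [u [u1 uS]]] := symmetric_eigenvector symS.
have [P [P1 Pu]] := householder u1.
have PT1 : P^T *m P = 1%:M by exact: mulmx1C.
have [T TE] : exists T : 'M[R]_(1 + n), T = P *m S *m P^T by eexists.
have TT : T^T = T by rewrite TE !trmx_mul trmxK symS mulmxA.
have T0 j : T (lshift n 0) j = x *+ (j == lshift n 0).
  have <- : row 0 T 0 j = T (lshift n 0) j by rewrite mxE; congr (T _ _); apply: val_inj.
  rewrite TE !row_mul Pu uS -scalemxAl -Pu -row_mul P1 !mxE -[RHS]mulr_natr eq_sym.
  by congr (_ * (_ == _)%:R); apply: val_inj.
have T0' i : T i (lshift n 0) = x *+ (i == lshift n 0) by rewrite -TT mxE T0.
have [Q [d [Q1 Td]]] : exists (Q : 'M[R]_n) (d : 'rV[R]_n),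
    Q *m Q^T = 1%:M /\ drsubmx T = Q^T *m diag_mx d *m Q.
  by apply: IHn; rewrite trmx_drsub TT.
have Tblock : T = block_mx x%:M 0 0 (drsubmx T).
  rewrite -[LHS]submxK; congr block_mx; apply/matrixP=> i j; rewrite ?ord1 !mxE.
  - by rewrite T0.
  - by rewrite T0 eq_rlshift.
  - by rewrite T0' eq_rlshift.
pose W : 'M[R]_(1 + n) := block_mx 1%:M 0 0 Q.
have WT : W^T = block_mx 1%:M 0 0 Q^T by rewrite /W tr_block_mx !trmx0 trmx1.
have WW : W *m W^T = 1%:M.
  rewrite WT /W mulmx_block !(mulmx0, mul0mx, addr0, add0r, mulmx1) Q1.
  by rewrite -scalar_mx_block.
have WTW : T = W^T *m diag_mx (row_mx x%:M d) *m W.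
  rewrite WT Tblock Td diag_mx_row /W.
  rewrite !mulmx_block !(mulmx0, mul0mx, addr0, add0r, mulmx1, mul1mx).
  by congr block_mx; apply/matrixP=> i j; rewrite !ord1 !mxE eqxx.
exists (W *m P), (row_mx x%:M d); split.
  by rewrite trmx_mul mulmxA -[W *m P *m _]mulmxA P1 mulmx1 WW.
have -> : S = P^T *m T *m P.
  by rewrite TE -!mulmxA PT1 mulmx1 mulmxA PT1 mul1mx.
by rewrite trmx_mul {1}WTW !mulmxA.
Qed.

(** * Frobenius norm and functional calculus *)

Section Frobenius.
Context {R : realType} {N : nat}.
Implicit Types (A B S Q W : 'M[R]_N).

Lemma frob_dotE A B : frob_dot A B = \sum_i \sum_j A i j * B i j.
Proof.
rewrite /frob_dot /mxtrace exchange_big; apply: eq_bigr => j _ /=.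
by rewrite mxE; apply: eq_bigr => i _; rewrite mxE.
Qed.

Lemma frob_dotC A B : frob_dot A B = frob_dot B A.
Proof.
by rewrite !frob_dotE; apply: eq_bigr => i _; apply: eq_bigr => j _; rewrite mulrC.
Qed.

Lemma frob_dotDl A B S : frob_dot (A + B) S = frob_dot A S + frob_dot B S.
Proof. by rewrite /frob_dot linearD /= mulmxDl linearD. Qed.

Lemma frob_dotZl a A B : frob_dot (a *: A) B = a * frob_dot A B.
Proof. by rewrite /frob_dot linearZ /= -scalemxAl linearZ. Qed.

Lemma frob_dotNl A B : frob_dot (- A) B = - frob_dot A B.
Proof. by rewrite -scaleN1r frob_dotZl mulN1r. Qed.

Lemma frob_dotBl A B S : frob_dot (A - B) S = frob_dot A S - frob_dot B S.
Proof. by rewrite frob_dotDl frob_dotNl. Qed.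

Lemma frob_dotDr A B S : frob_dot S (A + B) = frob_dot S A + frob_dot S B.
Proof. by rewrite ![frob_dot S _]frob_dotC frob_dotDl. Qed.

Lemma frob_dotZr a A B : frob_dot A (a *: B) = a * frob_dot A B.
Proof. by rewrite ![frob_dot A _]frob_dotC frob_dotZl. Qed.

Lemma frob_dotBr A B S : frob_dot S (A - B) = frob_dot S A - frob_dot S B.
Proof. by rewrite ![frob_dot S _]frob_dotC frob_dotBl. Qed.

Lemma frob_dot_ge0 A : 0 <= frob_dot A A.
Proof.
by rewrite frob_dotE; apply: sumr_ge0 => i _; apply: sumr_ge0 => j _; rewrite -expr2 sqr_ge0.
Qed.

Lemma frob_ge0 A : 0 <= frob A. Proof. exact: sqrtr_ge0. Qed.

Lemma frob_sqr A : frob A ^+ 2 = frob_dot A A.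
Proof. by rewrite sqr_sqrtr ?frob_dot_ge0. Qed.

Lemma frobZ a A : frob (a *: A) = `|a| * frob A.
Proof. by rewrite /frob frob_dotZl frob_dotZr mulrA -expr2 sqrtrM ?sqr_ge0 // sqrtr_sqr. Qed.

Lemma frob0 : frob (0 : 'M[R]_N) = 0.
Proof. by rewrite -(scale0r 0) frobZ normr0 mul0r. Qed.

Lemma frobN A : frob (- A) = frob A.
Proof. by rewrite -scaleN1r frobZ normrN1 mul1r. Qed.

Lemma frob_eq0 A : frob A = 0 -> A = 0.
Proof.
move=> A0; have /eqP : frob_dot A A = 0 by rewrite -frob_sqr A0 expr0n.
rewrite frob_dotE psumr_eq0; last first.
  by move=> i _; apply: sumr_ge0 => j _; rewrite -expr2 sqr_ge0.
move=> /allP Ai; apply/matrixP=> i j; rewrite mxE.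
have := Ai i (mem_index_enum i).
rewrite psumr_eq0; last by move=> k _; rewrite -expr2 sqr_ge0.
by move=> /allP/(_ j (mem_index_enum j)) /=; rewrite mulf_eq0 orbb => /eqP.
Qed.

(** The square of |B| A - |A| B is nonnegative. *)
Lemma frob_CauchySchwarz A B : frob_dot A B <= frob A * frob B.
Proof.
have [B0|B0] := eqVneq (frob B) 0.
  by rewrite B0 mulr0 (frob_eq0 B0) -(scale0r (0 : 'M[R]_N)) frob_dotZr mul0r.
have B_gt0 : 0 < frob B by rewrite lt_neqAle eq_sym B0 frob_ge0.
have := frob_dot_ge0 (frob B *: A - frob A *: B).
rewrite !(frob_dotBl, frob_dotBr, frob_dotZl, frob_dotZr) -!frob_sqr [frob_dot B A]frob_dotC.
have [A0|A0] := eqVneq (frob A) 0.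
  by rewrite A0 (frob_eq0 A0) -(scale0r (0 : 'M[R]_N)) frob_dotZl !mul0r.
have A_gt0 : 0 < frob A by rewrite lt_neqAle eq_sym A0 frob_ge0.
set x := frob_dot A B; set a := frob A; set b := frob B => h.
have : 0 <= 2 * (a * b) * (a * b - x) by apply: le_trans h _; rewrite le_eqVlt; apply/orP; left; apply/eqP; ring.
by rewrite pmulr_rge0 ?mulr_gt0 // subr_ge0.
Qed.

Lemma frob_triangle A B : frob (A + B) <= frob A + frob B.
Proof.
rewrite -(@ler_pXn2r _ 2) ?nnegrE ?frob_ge0 ?addr_ge0 ?frob_ge0 //.
rewrite frob_sqr frob_dotDl !frob_dotDr [frob_dot B A]frob_dotC -!frob_sqr.
have := frob_CauchySchwarz A B.
set x := frob_dot A B; set a := frob A; set b := frob B => h; nra.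
Qed.

Lemma frob_orth Q W A : Q *m Q^T = 1%:M -> W *m W^T = 1%:M ->
  frob (Q^T *m A *m W) = frob A.
Proof.
move=> Q1 W1; rewrite /frob /frob_dot !trmx_mul trmxK; congr Num.sqrt.
rewrite -!mulmxA [Q *m _]mulmxA Q1 mul1mx mxtrace_mulC -!mulmxA W1 mulmx1.
by [].
Qed.

Lemma frob_diag (d : 'rV[R]_N) : frob (diag_mx d) ^+ 2 = \sum_i d 0 i ^+ 2.
Proof.
rewrite frob_sqr frob_dotE; apply: eq_bigr => i _; rewrite (bigD1 i) //= big1.
  by rewrite !mxE eqxx addr0 expr2.
by move=> j /negPf ji; rewrite mxE eq_sym ji mul0r.
Qed.

(** Two diagonalizations of one matrix are intertwined by an orthogonal matrix
    whose nonzero entries only link equal eigenvalues; such a matrix also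
    intertwines the images of the eigenvalues under any function. *)
Lemma mxfunE (f : R -> R) Q (d : 'rV[R]_N) : Q *m Q^T = 1%:M ->
  mxfun f (Q^T *m diag_mx d *m Q) = Q^T *m diag_mx (map_mx f d) *m Q.
Proof.
move=> Q1; set S := Q^T *m _ *m Q; rewrite /mxfun.
have [] : orth_diag S (xget (1%:M, 0) (orth_diag S)).
  by apply: xgetPex; exists (Q, d); split.
case: (xget _ _) => W e /= W1 SE.
have [C CE] : exists C, C = W *m Q^T by eexists.
have W1' := mulmx1C W1; have Q1' := mulmx1C Q1.
have CD : C *m diag_mx d = diag_mx e *m C.
  rewrite CE; transitivity (W *m S *m Q^T).
    by rewrite /S -!mulmxA Q1 mulmx1.
  by rewrite SE !mulmxA W1 mul1mx.
have CfD : C *m diag_mx (map_mx f d) = diag_mx (map_mx f e) *m C.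
  apply/matrixP=> i j; have CED : C i j * d 0 j = e 0 i * C i j.
    by move/matrixP/(_ i j): CD; rewrite mul_mx_diag mul_diag_mx mxE [in X in _ = X -> _]mxE.
  rewrite mul_mx_diag mul_diag_mx [LHS]mxE [RHS]mxE ![map_mx f _ _ _]mxE.
  have [->|C0] := eqVneq (C i j) 0; first by rewrite !(mul0r, mulr0).
  by move: CED; rewrite [RHS]mulrC => /(mulfI C0) ->; rewrite mulrC.
have WC : W^T *m C = Q^T by rewrite CE mulmxA W1' mul1mx.
have CQ : C *m Q = W by rewrite CE -mulmxA Q1' mulmx1.
by rewrite -WC -[W^T *m C *m _]mulmxA CfD -!mulmxA CQ.
Qed.

End Frobenius.

(** * Simultaneous diagonalization by congruence *)

(* From here on the functional calculus enters only through its values on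
   diagonalized matrices. *)
Opaque mxfun.

Section CongruenceDiagonalization.
Context {R : realType} {N : nat}.
Implicit Types (A B C G H S Q T W : 'M[R]_N) (l d : 'rV[R]_N).

Definition expdiag l : 'M[R]_N := diag_mx (map_mx (@expR R) l).

Lemma expdiagD l d : expdiag l *m expdiag d = expdiag (l + d).
Proof.
rewrite /expdiag mul_diag_mx; apply/matrixP=> i j; rewrite !mxE expRD.
by rewrite mulrnAr.
Qed.

Lemma expdiag0 : expdiag 0 = 1%:M.
Proof. by apply/matrixP=> i j; rewrite !mxE expR0. Qed.

Lemma tr_expdiag l : (expdiag l)^T = expdiag l.
Proof. by rewrite tr_diag_mx. Qed.

Lemma expdiagN l : expdiag l *m expdiag (- l) = 1%:M.
Proof. by rewrite expdiagD subrr expdiag0. Qed.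

Lemma expdiag_unitmx l : expdiag l \in unitmx.
Proof. by have /mulmx1_unit[] := expdiagN l. Qed.

Lemma mxtrace_expdiag l : \tr (expdiag l) = \sum_i expR (l 0 i).
Proof. by rewrite mxtrace_diag; apply: eq_bigr => i _; rewrite mxE. Qed.

(** The pairs (G, H) of positive definite matrices in coordinates where G is the
    identity and H is diagonal.  The entries of l are the logarithms of the
    generalized eigenvalues, and t |-> C exp(t l) C^T is the geodesic from G to
    H. *)
Definition congruent_diag C l G H : Prop :=
  [/\ C \in unitmx, G = C *m C^T & H = C *m expdiag l *m C^T].

Lemma spd_tr S : spd S -> S^T = S.
Proof. by case=> /symmetricmxP. Qed.

Lemma tr_unitmx C : C \in unitmx -> C^T \in unitmx.
Proof. by rewrite unitmx_tr. Qed.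

Lemma orth_unitmx Q : Q *m Q^T = 1%:M -> Q \in unitmx.
Proof. by case/mulmx1_unit. Qed.

Lemma spd_expdiag C l : C \in unitmx -> spd (C *m expdiag l *m C^T).
Proof.
move=> Cu; split; first by apply/symmetricmxP; rewrite !trmx_mul trmxK tr_expdiag mulmxA.
move=> v v0; have w0 : C^T *m v != 0.
  apply: contra v0 => /eqP/(congr1 (mulmx (invmx C^T))).
  by rewrite mulKmx ?tr_unitmx // mulmx0 => ->.
rewrite !mulmxA -mulmxA -[v^T *m C]trmxK trmx_mul trmxK.
move: (C^T *m v) w0 => w w0; rewrite mul_mx_diag mxE.
rewrite (eq_bigr (fun i => expR (l 0 i) * w i 0 ^+ 2)); last first.
  by move=> i _; rewrite !mxE mulrAC expr2 mulrC.
rewrite lt_neqAle sumr_ge0 ?andbT; last by move=> i _; rewrite mulr_ge0 ?expR_ge0 ?sqr_ge0.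
apply: contra w0 => /eqP/esym/psumr_eq0P w0; apply/eqP/matrixP=> i j.
rewrite ord1 [RHS]mxE.
have /eqP := w0 (fun k _ => mulr_ge0 (expR_ge0 _) (sqr_ge0 _)) i isT.
by rewrite mulf_eq0 gt_eqF ?expR_gt0 //= sqrf_eq0 => /eqP.
Qed.

Lemma spd_spectral S : spd S ->
  exists Q l, Q *m Q^T = 1%:M /\ S = Q^T *m expdiag l *m Q.
Proof.
move=> Sspd; have [Q [d [Q1 SE]]] := spectral_theorem (spd_tr Sspd).
have d_gt0 i : 0 < d 0 i.
  have /(_ (Q^T *m delta_mx i 0)) := Sspd.2.
  have -> : (Q^T *m delta_mx i 0)^T *m S *m (Q^T *m delta_mx i 0) = (d 0 i)%:M :> 'M[R]_1.
    rewrite SE trmx_mul trmxK trmx_delta -!mulmxA !(mulmxA Q Q^T) Q1 !mul1mx mulmxA -rowE -colE.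
    by apply/matrixP=> a b; rewrite !ord1 !mxE !eqxx.
  rewrite mxE eqxx; apply; apply/eqP => /(congr1 (mulmx Q)).
  rewrite mulmxA Q1 mul1mx mulmx0 => /matrixP/(_ i 0)/eqP.
  by rewrite !mxE !eqxx oner_eq0.
exists Q, (map_mx (@ln R) d); split=> //; rewrite SE; congr (_ *m _ *m _).
congr diag_mx; apply/matrixP=> i j; rewrite ord1 !mxE lnK //.
exact: d_gt0.
Qed.

Lemma spd_congr C S : C \in unitmx -> spd S -> spd (C *m S *m C^T).
Proof.
move=> Cu /spd_spectral[Q [l [Q1 ->]]].
have -> : C *m (Q^T *m expdiag l *m Q) *m C^T = (C *m Q^T) *m expdiag l *m (C *m Q^T)^T.
  by rewrite trmx_mul trmxK !mulmxA.
by apply: spd_expdiag; rewrite unitmx_mul Cu tr_unitmx ?orth_unitmx.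
Qed.

Lemma spd_mulmx_tr C : C \in unitmx -> spd (C *m C^T).
Proof. by move/(spd_expdiag 0); rewrite expdiag0 mulmx1. Qed.

Lemma mxlog_expdiag Q l : Q *m Q^T = 1%:M ->
  mxlog (Q^T *m expdiag l *m Q) = Q^T *m diag_mx l *m Q.
Proof.
move=> Q1; rewrite /mxlog mxfunE //; congr (_ *m diag_mx _ *m _).
by apply/matrixP=> i j; rewrite !mxE expRK.
Qed.

Lemma mxsqrtV_expdiag Q l : Q *m Q^T = 1%:M ->
  mxsqrtV (Q^T *m expdiag l *m Q) = Q^T *m expdiag (- (2^-1 *: l)) *m Q.
Proof.
move=> Q1; rewrite /mxsqrtV mxfunE //; congr (_ *m diag_mx _ *m _).
apply/matrixP=> i j; rewrite !mxE expRN; congr (_^-1).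
have -> : expR (l i j) = expR (2^-1 * l i j) ^+ 2.
  by rewrite -expRM_natl; congr expR; field.
by rewrite sqrtr_sqr ger0_norm ?expR_ge0.
Qed.

(** W = G^(-1/2) is symmetric, invertible, and whitens G. *)
Lemma mxsqrtVP G : spd G ->
  [/\ (mxsqrtV G)^T = mxsqrtV G, mxsqrtV G \in unitmx & mxsqrtV G *m G *m mxsqrtV G = 1%:M].
Proof.
case/spd_spectral=> Q [l [Q1 ->]]; rewrite mxsqrtV_expdiag //.
set h := - (2^-1 *: l); set E := expdiag h; set W := Q^T *m E *m Q.
have WT : W^T = W by rewrite /W !trmx_mul trmxK tr_expdiag mulmxA.
have WSW : W *m (Q^T *m expdiag l *m Q) *m W = 1%:M.
  rewrite /W -!mulmxA !(mulmxA Q Q^T) Q1 !mul1mx (mulmxA (expdiag l)) expdiagD.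
  rewrite (mulmxA E) expdiagD.
  have -> : h + (l + h) = 0.
    by rewrite /h; apply/matrixP=> i j; rewrite !mxE; field.
  by rewrite expdiag0 mul1mx (mulmx1C Q1).
by split=> //; move/mulmx1_unit: WSW => [].
Qed.

Lemma congruent_diag_exists G H : spd G -> spd H ->
  exists C l, congruent_diag C l G H.
Proof.
move=> Gs Hs; have [WT Wu WGW] := mxsqrtVP Gs; set W := mxsqrtV G in WT Wu WGW.
have : spd (W *m H *m W) by rewrite -{2}WT; exact: spd_congr.
case/spd_spectral=> Q [l [Q1 WHW]]; exists (invmx W *m Q^T), l; split.
- by rewrite unitmx_mul unitmx_inv Wu tr_unitmx ?orth_unitmx.
- rewrite trmx_mul trmxK trmx_inv WT mulmxA -[_ *m Q^T *m Q]mulmxA (mulmx1C Q1) mulmx1.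
  apply: (can_inj (mulKmx Wu)); rewrite mulmxA mulmxV // mul1mx.
  by apply: (can_inj (mulmxK Wu)); rewrite WGW mulVmx.
- rewrite trmx_mul trmxK trmx_inv WT.
  have -> : invmx W *m Q^T *m expdiag l *m (Q *m invmx W) = invmx W *m (W *m H *m W) *m invmx W.
    by rewrite WHW !mulmxA.
  by rewrite -mulmxA mulmxK // mulKmx.
Qed.

Lemma congruent_diag_spd C l G H : congruent_diag C l G H -> spd G /\ spd H.
Proof. by case=> Cu -> ->; split; [exact: spd_mulmx_tr|exact: spd_expdiag]. Qed.

(** G = C C^T makes C^T G^(-1/2) orthogonal, so that l is also the logarithm of
    the spectrum of the whitened matrix. *)
Lemma congruent_diag_whiten C l G H : congruent_diag C l G H ->
  let Q := C^T *m mxsqrtV G in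
  Q *m Q^T = 1%:M /\ whiten G H = Q^T *m expdiag l *m Q.
Proof.
move=> CGH; have [Gs _] := congruent_diag_spd CGH; case: CGH => Cu GE HE.
case: (mxsqrtVP Gs); rewrite /whiten HE; move: (mxsqrtV G) => W WT Wu WGW.
split; last by rewrite trmx_mul trmxK WT !mulmxA.
by apply: mulmx1C; rewrite trmx_mul trmxK WT -!mulmxA (mulmxA C) -GE mulmxA.
Qed.

Lemma mxlog_whiten C l G H : congruent_diag C l G H ->
  mxlog (whiten G H) = (C^T *m mxsqrtV G)^T *m diag_mx l *m (C^T *m mxsqrtV G).
Proof. by case/congruent_diag_whiten=> Q1 ->; rewrite mxlog_expdiag. Qed.

Lemma dAI_sqr C l G H : congruent_diag C l G H ->
  dAI G H ^+ 2 = \sum_i l 0 i ^+ 2.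
Proof.
move=> CGH; rewrite /dAI (mxlog_whiten CGH) frob_orth ?frob_diag //;
by case: (congruent_diag_whiten CGH).
Qed.

Lemma dAI_ge0 G H : 0 <= dAI G H. Proof. exact: frob_ge0. Qed.

Lemma dAI_sqrt C l G H : congruent_diag C l G H ->
  dAI G H = Num.sqrt (\sum_i l 0 i ^+ 2).
Proof. by move/dAI_sqr <-; rewrite sqrtr_sqr ger0_norm ?dAI_ge0. Qed.

Opaque dAI.

Lemma dAI_eq C l C' l' G H G' H' : congruent_diag C l G H ->
  congruent_diag C' l' G' H' -> (forall i, l' 0 i ^+ 2 = l 0 i ^+ 2) ->
  dAI G H = dAI G' H'.
Proof.
move=> /dAI_sqrt -> /dAI_sqrt -> ll; congr Num.sqrt.
by apply: eq_bigr => i _; rewrite ll.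
Qed.

(** Any two points of a geodesic are diagonalized by a congruence that differs
    from C by a diagonal factor depending on the base point s alone; in
    particular one congruence serves the two directions along the geodesic
    leaving that point. *)
Lemma congruent_diag_geodesic C l G H (s t : R) : congruent_diag C l G H ->
  congruent_diag (C *m expdiag ((s / 2) *: l)) ((t - s) *: l)
    (C *m expdiag (s *: l) *m C^T) (C *m expdiag (t *: l) *m C^T).
Proof.
case=> Cu _ _; set E := expdiag ((s / 2) *: l).
have EE : E *m E = expdiag (s *: l).
  by rewrite expdiagD -scalerDl; have -> : s / 2 + s / 2 = s by field.
have EEE : E *m expdiag ((t - s) *: l) *m E = expdiag (t *: l).
  by rewrite /E !expdiagD -!scalerDl; have -> : s / 2 + (t - s) + s / 2 = t by field.
split; first by rewrite unitmx_mul Cu expdiag_unitmx.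
  by rewrite trmx_mul tr_expdiag -EE !mulmxA.
by rewrite trmx_mul tr_expdiag -EEE !mulmxA.
Qed.

Lemma geodesic0 C l G H : congruent_diag C l G H -> C *m expdiag (0 *: l) *m C^T = G.
Proof. by case=> _ -> _; rewrite scale0r expdiag0 mulmx1. Qed.

Lemma geodesic1 C l G H : congruent_diag C l G H -> C *m expdiag (1 *: l) *m C^T = H.
Proof. by case=> _ _ ->; rewrite scale1r. Qed.

Lemma congruent_diag_sym C l G H : congruent_diag C l G H ->
  exists C', congruent_diag C' (- l) H G.
Proof.
move=> CGH; have := congruent_diag_geodesic 1 0 CGH.
set C' := C *m _; move=> h; exists C'; move: h.
by rewrite (geodesic0 CGH) (geodesic1 CGH) sub0r scaleN1r.
Qed.

Lemma congruent_diag_congr T C l G H : T \in unitmx -> congruent_diag C l G H ->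
  congruent_diag (T *m C) l (T *m G *m T^T) (T *m H *m T^T).
Proof.
move=> Tu [Cu -> ->]; split; first by rewrite unitmx_mul Tu.
  by rewrite trmx_mul !mulmxA.
by rewrite trmx_mul !mulmxA.
Qed.

Lemma dAI_sym G H : spd G -> spd H -> dAI G H = dAI H G.
Proof.
move=> Gs Hs; have [C [l CGH]] := congruent_diag_exists Gs Hs.
have [C' CHG] := congruent_diag_sym CGH.
by apply: dAI_eq CGH CHG _ => i; rewrite mxE sqrrN.
Qed.

Lemma dAI_congr T G H : T \in unitmx -> spd G -> spd H ->
  dAI (T *m G *m T^T) (T *m H *m T^T) = dAI G H.
Proof.
move=> Tu Gs Hs; have [C [l CGH]] := congruent_diag_exists Gs Hs.
by apply/esym; apply: dAI_eq CGH (congruent_diag_congr Tu CGH) _ => i.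
Qed.

Lemma whitenE G H : spd G -> whiten G H = mxsqrtV G *m H *m (mxsqrtV G)^T.
Proof. by case/mxsqrtVP=> -> _ _. Qed.

Lemma whiten_spd G H : spd G -> spd H -> spd (whiten G H).
Proof.
by move=> Gs Hs; rewrite whitenE //; apply: spd_congr => //; case: (mxsqrtVP Gs).
Qed.

Lemma dAI_whiten T G H : spd T -> spd G -> spd H ->
  dAI (whiten T G) (whiten T H) = dAI G H.
Proof. by move=> Ts Gs Hs; rewrite (whitenE G Ts) (whitenE H Ts) dAI_congr //; case: (mxsqrtVP Ts). Qed.

End CongruenceDiagonalization.

(** * Scalar bounds on the hyperbolic cosine *)

Section ScalarBounds.
Context {R : realType}.
Implicit Types x y d : R.

Lemma le_of_le_expRM x d : 0 <= d -> (forall e, 0 < e -> x <= expR e * d) -> x <= d.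
Proof.
move=> d0 h; have [//|dx] := leP x d.
move: d0; rewrite le_eqVlt => /orP[/eqP d0|d_gt0].
  by have := h 1 ltr01; rewrite -d0 mulr0 => x0; rewrite -d0 ltNge x0 in dx.
have x_gt0 : 0 < x by apply: lt_trans dx.
have e0 : 0 < ln (x / d) by rewrite ln_gt0 // ltr_pdivlMr // mul1r.
have e2 : 0 < ln (x / d) / 2 by rewrite divr_gt0.
have := h _ e2; rewrite -ler_pdivrMr // -{1}[x / d]lnK ?posrE ?divr_gt0 // ler_expR.
by move=> h1; lra.
Qed.

(** Twice the hyperbolic sine. *)
Definition sinh2 y : R := expR y - expR (- y).

Lemma sinh2_le y : 0 <= y -> sinh2 y <= 2 * y * expR y.
Proof.
move=> y0; have := expR_ge1Dx (2 * - y); have := expR_gt0 y.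
have -> : expR (2 * - y) = expR (- y) ^+ 2 by rewrite -expRM_natl.
have : expR y * expR (- y) = 1 by rewrite -expRD subrr expR0.
rewrite /sinh2; move: (expR y) (expR (- y)) => a b ab a0 h.
have : a * (1 + 2 * - y) <= a * b ^+ 2 by rewrite ler_pM2l.
have -> : a * b ^+ 2 = b by rewrite expr2 mulrA ab mul1r.
by move=> h1; lra.
Qed.

Lemma sinh2_ge0 y : 0 <= y -> 0 <= sinh2 y.
Proof. by move=> y0; rewrite subr_ge0 ler_expR; lra. Qed.

(** Halving the argument reduces the claim to small arguments at no loss, since
    sinh y >= 2 sinh (y/2); there e^t >= 1 + t applied to t = 2y is sharp up to
    the factor e^y. *)
Lemma sinh2_ge y : 0 <= y -> 2 * y <= sinh2 y.
Proof.
have hk k : forall y, 0 <= y -> 2 * y <= expR (y / 2 ^+ k) * sinh2 y.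
  elim: k => [|k IHk] {}y y0.
    have := expR_ge1Dx (2 * y); rewrite expr0 divr1 /sinh2 mulrBr -!expRD subrr expR0.
    by rewrite -[y + y]mulr2n -[y *+ 2]mulr_natl => h; lra.
  have y20 : 0 <= y / 2 by rewrite divr_ge0.
  have := IHk _ y20; set e := expR _.
  have -> : expR (y / 2 ^+ k.+1) = e by congr expR; rewrite exprS invfM mulrA.
  have -> : sinh2 y = sinh2 (y / 2) * (expR (y / 2) + expR (- (y / 2))).
    by rewrite /sinh2 -subr_sqr -!expRM_natl; congr (expR _ - expR _); field.
  have : 2 <= expR (y / 2) + expR (- (y / 2)).
    by have := expR_ge1Dx (y / 2); have := expR_ge1Dx (- (y / 2)); lra.
  have := sinh2_ge0 y20; have : 0 < e by exact: expR_gt0.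
  move: (sinh2 _) (expR _ + expR _) => s c e0 s0 c2 h.
  have : e * s * 2 <= e * s * c by rewrite ler_wpM2l // mulr_ge0 // ltW.
  by rewrite -mulrA => h1; lra.
move=> y0; apply: le_of_le_expRM => [|e e0]; first exact: sinh2_ge0.
have [k ek] : exists k, y / 2 ^+ k <= e.
  exists (Num.truncn (y / e)).+1.
  rewrite ler_pdivrMr ?exprn_gt0 // mulrC -ler_pdivrMr //.
  apply: le_trans (ltW (truncnS_gt _)) _.
  by rewrite -natrX ler_nat ltnW // ltn_expl.
by apply: le_trans (hk k _ y0) _; rewrite ler_wpM2r ?sinh2_ge0 // ler_expR.
Qed.

(** 2 (cosh x - 1), the contribution to J of a pair of eigenvalues of ratio e^x. *)
Definition coshgap x : R := expR x + expR (- x) - 2.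

Lemma coshgapN x : coshgap (- x) = coshgap x.
Proof. by rewrite /coshgap opprK [expR (- x) + _]addrC. Qed.

Lemma coshgap_sinh2 x : coshgap x = sinh2 (x / 2) ^+ 2.
Proof.
have -> : x = x / 2 + x / 2 by field.
rewrite /coshgap /sinh2; have -> : (x / 2 + x / 2) / 2 = x / 2 by field.
move: (x / 2) => y; rewrite opprD !expRD.
have : expR y * expR (- y) = 1 by rewrite -expRD subrr expR0.
move: (expR y) (expR (- y)) => a b ab; rewrite sqrrB ab; ring.
Qed.

Lemma coshgap_bounds x : x ^+ 2 <= coshgap x <= expR `|x| * x ^+ 2.
Proof.
wlog x0 : x / 0 <= x => [hw|].
  have [/hw//|x0] := leP 0 x.
  by have := hw (- x); rewrite coshgapN normrN sqrrN; apply; lra.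
have y0 : 0 <= x / 2 by rewrite divr_ge0.
have := sinh2_ge y0; have := sinh2_le y0; rewrite coshgap_sinh2 ger0_norm //.
have -> : expR x = expR (x / 2) ^+ 2 by rewrite -expRM_natl; congr expR; field.
have -> : x ^+ 2 = (2 * (x / 2)) ^+ 2 by congr (_ ^+ _); field.
rewrite -exprMn [expR _ * _]mulrC => h1 h2.
by rewrite !ler_pXn2r ?nnegrE ?sinh2_ge0 ?mulr_ge0 ?expR_ge0 ?h1 ?h2.
Qed.

End ScalarBounds.

(** * The exponential metric increasing property *)

Opaque mxsqrtV mxlog whiten.

Section Jeffreys.
Context {R : realType} {N : nat}.
Implicit Types (A B C G H S P Q T W : 'M[R]_N) (a b l d : 'rV[R]_N).

(** Twice the symmetrized Kullback-Leibler (Jeffreys) divergence of the centered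
    Gaussian laws with covariances A and B.  It compares the distance dAI with
    the Frobenius distance of the logarithms because it has a closed form both
    under a simultaneous congruence and in two separate eigenbases. *)
Definition jeffreys A B : R :=
  \tr (invmx A *m B) + \tr (invmx B *m A) - 2 * N%:R.

Lemma invmxE A B : A *m B = 1%:M -> invmx A = B.
Proof.
by move=> AB; have [Au _] := mulmx1_unit AB; rewrite -[B](mulKmx Au) AB mulmx1.
Qed.

Lemma congruent_diag_jeffreys C l A B : congruent_diag C l A B ->
  jeffreys A B = \sum_i coshgap (l 0 i).
Proof.
case=> Cu -> ->; have Ctu := tr_unitmx Cu.
have e1 : \tr (invmx (C *m C^T) *m (C *m expdiag l *m C^T)) = \tr (expdiag l).
  rewrite (@invmxE _ (invmx C^T *m invmx C)); last first.
    by rewrite mulmxA mulmxK // mulmxV.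
  by rewrite -!mulmxA mulKmx // mxtrace_mulC -!mulmxA mulmxV // mulmx1.
have e2 : \tr (invmx (C *m expdiag l *m C^T) *m (C *m C^T)) = \tr (expdiag (- l)).
  rewrite (@invmxE _ (invmx C^T *m expdiag (- l) *m invmx C)); last first.
    by rewrite !mulmxA mulmxK // -(mulmxA C) expdiagN mulmx1 mulmxV.
  by rewrite -!mulmxA mulKmx // mxtrace_mulC -!mulmxA mulmxV // mulmx1.
rewrite /jeffreys e1 e2 !mxtrace_expdiag -big_split /=.
have -> : 2 * N%:R = \sum_(i < N) 2 :> R by rewrite sumr_const card_ord mulr_natr.
by rewrite -sumrB; apply: eq_bigr => i _; rewrite mxE.
Qed.

(** This expresses traces of products through the squared overlaps C i j ^+ 2 of
    two eigenbases. *)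
Lemma mxtrace_sandwich a b C :
  \tr (diag_mx a *m C *m diag_mx b *m C^T) = \sum_i \sum_j C i j ^+ 2 * (a 0 i * b 0 j).
Proof.
apply: eq_bigr => i _; rewrite mxE; apply: eq_bigr => j _.
rewrite mul_mx_diag mul_diag_mx !mxE; ring.
Qed.

Lemma jeffreys_spectral Q a W b : Q *m Q^T = 1%:M -> W *m W^T = 1%:M ->
  jeffreys (Q^T *m expdiag a *m Q) (W^T *m expdiag b *m W) =
  \sum_i \sum_j (Q *m W^T) i j ^+ 2 * coshgap (b 0 j - a 0 i).
Proof.
have inv Q' a' : Q' *m Q'^T = 1%:M ->
    invmx (Q'^T *m expdiag a' *m Q') = Q'^T *m expdiag (- a') *m Q'.
  move=> Q1; apply: invmxE; rewrite -!mulmxA (mulmxA Q') Q1 mul1mx.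
  by rewrite (mulmxA (expdiag _)) expdiagN mul1mx mulmx1C.
have tr Q' a' W' b' : \tr (Q'^T *m expdiag a' *m Q' *m (W'^T *m expdiag b' *m W')) =
    \sum_i \sum_j (Q' *m W'^T) i j ^+ 2 * expR (a' 0 i + b' 0 j).
  rewrite -!mulmxA mxtrace_mulC.
  transitivity (\tr (expdiag a' *m (Q' *m W'^T) *m expdiag b' *m (Q' *m W'^T)^T)).
    by rewrite trmx_mul trmxK !mulmxA.
  rewrite mxtrace_sandwich; apply: eq_bigr => i _; apply: eq_bigr => j _.
  by rewrite !mxE expRD.
move=> Q1 W1; rewrite /jeffreys !inv // !tr.
(* The squared overlaps form a doubly stochastic matrix. *)
have -> : N%:R = \sum_i \sum_j (Q *m W^T) i j ^+ 2 :> R.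
  transitivity (\tr (diag_mx (const_mx 1) *m (Q *m W^T) *m diag_mx (const_mx 1) *m (Q *m W^T)^T) : R).
    rewrite diag_const_mx mul1mx mulmx1 trmx_mul trmxK -mulmxA (mulmxA W^T) (mulmx1C W1).
    by rewrite mul1mx Q1 mxtrace1.
  rewrite mxtrace_sandwich; apply: eq_bigr => i _; apply: eq_bigr => j _.
  by rewrite !mxE !mulr1.
rewrite [X in _ + X - _]exchange_big /= -big_split mulr_sumr -sumrB /=.
apply: eq_bigr => i _; rewrite -big_split mulr_sumr -sumrB /=; apply: eq_bigr => j _.
have -> : (W *m Q^T) j i = (Q *m W^T) i j.
  by rewrite -[in LHS](trmxK W) -trmx_mul mxE.
rewrite [(- a) _ _]mxE [(- b) _ _]mxE /coshgap opprB [- a 0 i + _]addrC [- b 0 j + _]addrC.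
by rewrite !mulrDr mulrN [2 * _]mulrC.
Qed.

Lemma frob_sub_spectral Q a W b : Q *m Q^T = 1%:M -> W *m W^T = 1%:M ->
  frob (Q^T *m diag_mx a *m Q - W^T *m diag_mx b *m W) ^+ 2 =
  \sum_i \sum_j (Q *m W^T) i j ^+ 2 * (b 0 j - a 0 i) ^+ 2.
Proof.
move=> Q1 W1; have [c cE] : exists c, c = Q *m W^T by eexists.
have -> : Q^T *m diag_mx a *m Q - W^T *m diag_mx b *m W =
    Q^T *m (diag_mx a *m c - c *m diag_mx b) *m W.
  rewrite mulmxBr mulmxBl cE !mulmxA (mulmx1C Q1) mul1mx; congr (_ - _).
  by rewrite -!mulmxA (mulmx1C W1) mulmx1.
rewrite frob_orth // frob_sqr frob_dotE -cE; apply: eq_bigr => i _; apply: eq_bigr => j _.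
by rewrite mul_mx_diag mul_diag_mx !mxE; ring.
Qed.

Lemma frob_mxlogB_sqr_le A B : spd A -> spd B ->
  frob (mxlog A - mxlog B) ^+ 2 <= jeffreys A B.
Proof.
move=> /spd_spectral[Q [a [Q1 ->]]] /spd_spectral[W [b [W1 ->]]].
rewrite !mxlog_expdiag // frob_sub_spectral // jeffreys_spectral //.
apply: ler_sum => i _; apply: ler_sum => j _.
by rewrite ler_wpM2l ?sqr_ge0 //; case/andP: (coshgap_bounds (b 0 j - a 0 i)).
Qed.

(** The converse comparison on bounded sets; it makes the exponential map locally
    Lipschitz. *)
Lemma jeffreys_le Q a W b (L : R) : Q *m Q^T = 1%:M -> W *m W^T = 1%:M ->
  (forall i j, `|b 0 j - a 0 i| <= L) ->
  jeffreys (Q^T *m expdiag a *m Q) (W^T *m expdiag b *m W) <=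
  expR L * frob (Q^T *m diag_mx a *m Q - W^T *m diag_mx b *m W) ^+ 2.
Proof.
move=> Q1 W1 abL; rewrite frob_sub_spectral // jeffreys_spectral // mulr_sumr.
apply: ler_sum => i _; rewrite mulr_sumr; apply: ler_sum => j _.
rewrite mulrCA ler_wpM2l ?sqr_ge0 //.
case/andP: (coshgap_bounds (b 0 j - a 0 i)) => _ /le_trans; apply.
by rewrite ler_wpM2r ?sqr_ge0 // ler_expR.
Qed.

Lemma dAI_sqr_le_jeffreys A B : spd A -> spd B -> dAI A B ^+ 2 <= jeffreys A B.
Proof.
move=> As Bs; have [C [l CAB]] := congruent_diag_exists As Bs.
rewrite (dAI_sqr CAB) (congruent_diag_jeffreys CAB); apply: ler_sum => i _.
by case/andP: (coshgap_bounds (l 0 i)).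
Qed.

(** Cut the geodesic from A to B into n equal steps.  On each step the difference
    of logarithms is at most the square root of J, hence at most e^e dAI A B / n
    once the steps are short; add up and let e tend to 0. *)
Theorem exponential_metric_increasing A B : spd A -> spd B ->
  frob (mxlog A - mxlog B) <= dAI A B.
Proof.
move=> As Bs; have [C [l CAB]] := congruent_diag_exists As Bs.
have Cu : C \in unitmx by case: CAB.
pose M := \sum_i `|l 0 i|.
have M0 : 0 <= M by apply: sumr_ge0 => i _.
have lM i : `|l 0 i| <= M.
  by rewrite /M (bigD1 i) //= lerDl sumr_ge0.
apply: le_of_le_expRM => [|e e0]; first exact: dAI_ge0.
(* Steps so short that every logarithmic eigenvalue ratio is at most e. *)
pose n := (Num.truncn (M / e)).+1.
have n0 : 0 < n%:R :> R by rewrite ltr0n.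
have Mn : M / n%:R <= e.
  by rewrite ler_pdivrMr // mulrC -ler_pdivrMr //; exact: ltW (truncnS_gt _).
pose P k := C *m expdiag ((k%:R / n%:R) *: l) *m C^T.
have Ps k : spd (P k) by exact: spd_expdiag.
have step k : frob (mxlog (P k) - mxlog (P k.+1)) <= expR e * dAI A B / n%:R.
  have CPP := congruent_diag_geodesic (k%:R / n%:R) (k.+1%:R / n%:R) CAB.
  rewrite -(@ler_pXn2r _ 2) ?nnegrE ?frob_ge0 ?divr_ge0 ?mulr_ge0 ?expR_ge0 ?dAI_ge0 //.
  apply: le_trans (frob_mxlogB_sqr_le (Ps k) (Ps k.+1)) _.
  rewrite (congruent_diag_jeffreys CPP) !exprMn (dAI_sqr CAB) mulr_sumr mulr_suml.
  apply: ler_sum => i _; rewrite mxE.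
  have -> : k.+1%:R / n%:R - k%:R / n%:R = n%:R^-1 :> R.
    by rewrite -mulrBl -natrB // subSnn mul1r.
  case/andP: (coshgap_bounds (n%:R^-1 * l 0 i)) => _ /le_trans; apply.
  rewrite exprMn mulrA mulrAC; rewrite ler_wpM2r ?sqr_ge0 // ler_wpM2r ?sqr_ge0 //.
  rewrite -expRM_natl ler_expR normrM ger0_norm ?invr_ge0 ?ltW //.
  have : n%:R^-1 * `|l 0 i| <= M / n%:R.
    by rewrite mulrC ler_wpM2r ?lM // invr_ge0 ltW.
  by lra.
have all k : frob (mxlog (P 0%N) - mxlog (P k)) <= k%:R * (expR e * dAI A B / n%:R).
  elim: k => [|k IHk].
    by rewrite subrr mul0r frob0.
  have -> : mxlog (P 0%N) - mxlog (P k.+1) =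
    (mxlog (P 0%N) - mxlog (P k)) + (mxlog (P k) - mxlog (P k.+1)) by rewrite addrA subrK.
  by apply: le_trans (frob_triangle _ _) _; rewrite -natr1 mulrDl mul1r lerD.
have := all n; rewrite /P mul0r (geodesic0 CAB) divff ?gt_eqF // (geodesic1 CAB).
by rewrite mulrC divfK ?gt_eqF.
Qed.

End Jeffreys.

(** * Nonpositive curvature *)

Section Hadamard.
Context {R : realType} {N : nat}.
Implicit Types (A B C G H S P Q T W : 'M[R]_N) (a b l d : 'rV[R]_N).

Lemma dAI_frob G H : dAI G H = frob (mxlog (whiten G H)).
Proof. by []. Qed.

(** The metric inequality based at T instead of the identity. *)
Lemma frob_mxlog_whitenB_le T G H : spd T -> spd G -> spd H ->
  frob (mxlog (whiten T G) - mxlog (whiten T H)) <= dAI G H.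
Proof.
move=> Ts Gs Hs; rewrite -(dAI_whiten Ts Gs Hs).
by apply: exponential_metric_increasing; exact: whiten_spd.
Qed.

Lemma dAI_triangle A B C : spd A -> spd B -> spd C -> dAI A C <= dAI A B + dAI B C.
Proof.
move=> As Bs Cs; rewrite [dAI A C]dAI_frob [dAI A B]dAI_frob.
have -> : mxlog (whiten A C) = mxlog (whiten A B) + (mxlog (whiten A C) - mxlog (whiten A B)).
  by rewrite addrC subrK.
apply: le_trans (frob_triangle _ _) _; rewrite lerD2l (dAI_sym Bs Cs).
exact: frob_mxlog_whitenB_le.
Qed.

Lemma dist_dAI_le A B H : spd H -> spd A -> spd B -> `|dAI H A - dAI H B| <= dAI A B.
Proof.
move=> Hs As Bs; have t1 := dAI_triangle Hs As Bs; have t2 := dAI_triangle Hs Bs As.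
rewrite (dAI_sym Bs As) in t2; move: t1 t2.
move: (dAI H A) (dAI H B) (dAI A B) => x y z t1 t2.
by rewrite ler_norml; apply/andP; split; lra.
Qed.

Lemma frob_sqrB A B : frob (A - B) ^+ 2 = frob A ^+ 2 + frob B ^+ 2 - 2 * frob_dot A B.
Proof.
rewrite !frob_sqr frob_dotBl !frob_dotBr [frob_dot B A]frob_dotC; ring.
Qed.

(** Expand the square of |Log_G H - Log_G G'|, which is at most dAI G' H. *)
Lemma law_of_cosines G G' H : spd G -> spd G' -> spd H ->
  dAI G H ^+ 2 + dAI G G' ^+ 2
    - 2 * frob_dot (mxlog (whiten G H)) (mxlog (whiten G G')) <= dAI G' H ^+ 2.
Proof.
move=> Gs Gs' Hs; rewrite [dAI G H]dAI_frob [dAI G G']dAI_frob -frob_sqrB.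
rewrite (dAI_sym Gs' Hs) ler_pXn2r ?nnegrE ?frob_ge0 ?dAI_ge0 //.
exact: frob_mxlog_whitenB_le.
Qed.

(** At T = C exp(t l) C^T the two ends of the geodesic have logarithms -t V and
    (1 - t) V.  In the average with weights 1 - t and t of the two laws of
    cosines based at T, the inner products with V cancel. *)
Lemma geodesic_convexity C l P G H (t : R) : congruent_diag C l P G -> spd H -> 0 <= t <= 1 ->
  dAI H (C *m expdiag (t *: l) *m C^T) ^+ 2 <=
  (1 - t) * dAI H P ^+ 2 + t * dAI H G ^+ 2 - t * (1 - t) * dAI P G ^+ 2.
Proof.
move=> CPG Hs /andP[t0 t1]; have [Ps Gs] := congruent_diag_spd CPG.
have Ts : spd (C *m expdiag (t *: l) *m C^T) by apply: spd_expdiag; case: CPG.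
have CTP := congruent_diag_geodesic t 0 CPG.
have CTG := congruent_diag_geodesic t 1 CPG.
rewrite (geodesic0 CPG) in CTP; rewrite (geodesic1 CPG) in CTG.
set T := C *m expdiag (t *: l) *m C^T in Ts CTP CTG *.
set C' := C *m _ in CTP CTG.
have logTP := mxlog_whiten CTP; have logTG := mxlog_whiten CTG.
have [Q1 _] := congruent_diag_whiten CTP.
set Q := C'^T *m mxsqrtV T in Q1 logTP logTG.
have [V [VE Vn]] : exists V, V = Q^T *m diag_mx l *m Q /\ frob V ^+ 2 = dAI P G ^+ 2.
  by eexists; split; first by []; rewrite frob_orth // frob_diag (dAI_sqr CPG).
have VZ c : Q^T *m diag_mx (c *: l) *m Q = c *: V.
  by rewrite VE linearZ /= -scalemxAr -scalemxAl.
rewrite !VZ in logTP logTG.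
have hP := law_of_cosines Ts Ps Hs; have hG := law_of_cosines Ts Gs Hs.
have TP : dAI T P ^+ 2 = t ^+ 2 * dAI P G ^+ 2.
  rewrite (dAI_sqr CTP) (dAI_sqr CPG) mulr_sumr; apply: eq_bigr => i _.
  by rewrite mxE sub0r exprMn sqrrN.
have TG : dAI T G ^+ 2 = (1 - t) ^+ 2 * dAI P G ^+ 2.
  rewrite (dAI_sqr CTG) (dAI_sqr CPG) mulr_sumr; apply: eq_bigr => i _.
  by rewrite mxE exprMn.
rewrite TP logTP frob_dotZr in hP; rewrite TG logTG frob_dotZr in hG.
rewrite (dAI_sym Hs Ts) (dAI_sym Hs Ps) (dAI_sym Hs Gs).
move: hP hG; move: (frob_dot _ _) (dAI T H ^+ 2) (dAI P H ^+ 2) (dAI G H ^+ 2) (dAI P G ^+ 2).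
move=> y hT fP fG d hP hG.
have hP' : (1 - t) * (hT + t ^+ 2 * d - 2 * ((0 - t) * y)) <= (1 - t) * fP.
  by rewrite ler_wpM2l // subr_ge0.
have hG' : t * (hT + (1 - t) ^+ 2 * d - 2 * ((1 - t) * y)) <= t * fG.
  by rewrite ler_wpM2l.
apply: le_trans (_ : (1 - t) * (hT + t ^+ 2 * d - 2 * ((0 - t) * y)) +
  t * (hT + (1 - t) ^+ 2 * d - 2 * ((1 - t) * y)) - t * (1 - t) * d <= _); last first.
  by rewrite lerD2r lerD.
rewrite le_eqVlt; apply/orP; left; apply/eqP; ring.
Qed.

(** Minimality of P along the geodesic bounds the left-hand side of convexity
    from below by dAI H P ^+ 2; divide by t and let t tend to 0. *)
Lemma pythagoras C l P G H : congruent_diag C l P G -> spd H ->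
  (forall t, dAI H P <= dAI H (C *m expdiag (t *: l) *m C^T)) ->
  dAI H P ^+ 2 + dAI P G ^+ 2 <= dAI H G ^+ 2.
Proof.
move=> CPG Hs minP.
have ht t : 0 < t < 1 -> dAI H P ^+ 2 + (1 - t) * dAI P G ^+ 2 <= dAI H G ^+ 2.
  move=> /andP[t0 t1].
  have t01 : 0 <= t <= 1 by rewrite !ltW.
  have := geodesic_convexity CPG Hs t01.
  have : dAI H P ^+ 2 <= dAI H (C *m expdiag (t *: l) *m C^T) ^+ 2.
    by rewrite ler_pXn2r ?nnegrE ?dAI_ge0.
  move=> /le_trans h {}/h; move: (dAI H P ^+ 2) (dAI H G ^+ 2) (dAI P G ^+ 2) => p g d h.
  by rewrite -(ler_pM2l t0); lra.
rewrite leNgt; apply/negP; have := sqr_ge0 (dAI P G); move: ht.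
move: (dAI H P ^+ 2) (dAI H G ^+ 2) (dAI P G ^+ 2) => p g d ht d0 gpd.
(* A defect e > 0 is contradicted by a t with t d < e. *)
pose e := p + d - g; have e0 : 0 < e by rewrite /e; lra.
have ed0 : 0 < 2 * (e + d) by lra.
have t01 : 0 < e / (2 * (e + d)) < 1.
  by rewrite divr_gt0 //= ltr_pdivrMr //; lra.
have := ht _ t01; have : e / (2 * (e + d)) * d < e.
  by rewrite mulrAC ltr_pdivrMr // ltr_pM2l //; lra.
by rewrite /e; lra.
Qed.

End Hadamard.

(** * The Kronecker family *)

Section Tensor.
Context {R : realType} {m n : nat}.
Implicit Types (G Z : 'M[R]_(n * m)) (A X W : 'M[R]_m) (B Y Q : 'M[R]_n).
Implicit Types (a : 'rV[R]_m) (b : 'rV[R]_n).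

Lemma big_mxtens (F : 'I_(n * m) -> R) :
  \sum_k F k = \sum_i \sum_j F (mxtens_index (i, j)).
Proof.
rewrite pair_big /=; apply: reindex; exists (@mxtens_unindex n m) => k _.
  by case: k => i j; rewrite mxtens_indexK.
exact: mxtens_unindexK.
Qed.

Lemma tensmx11 : (1%:M : 'M[R]_n) *t (1%:M : 'M[R]_m) = 1%:M.
Proof.
apply/matrixP=> i j; rewrite !mxE -natrM mulnb; congr (_ %:R); congr nat_of_bool.
rewrite -[RHS](inj_eq (can_inj (@mxtens_unindexK n m))).
by case: (mxtens_unindex i) (mxtens_unindex j) => [? ?] [? ?]; rewrite xpair_eqE.
Qed.

Lemma tens_unitmx B A : B \in unitmx -> A \in unitmx -> B *t A \in unitmx.
Proof.
move=> Bu Au; have : (B *t A) *m (invmx B *t invmx A) = 1%:M.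
  by rewrite tensmx_mul !mulmxV // tensmx11.
by case/mulmx1_unit.
Qed.

Lemma tensmxDl B B' A : (B + B') *t A = B *t A + B' *t A.
Proof. by apply/matrixP=> i j; rewrite !mxE mulrDl. Qed.

Lemma tensmxDr B A A' : B *t (A + A') = B *t A + B *t A'.
Proof. by apply/matrixP=> i j; rewrite !mxE mulrDr. Qed.

Lemma tensmxZl c B A : (c *: B) *t A = c *: (B *t A).
Proof. by apply/matrixP=> i j; rewrite !mxE mulrA. Qed.

Lemma tensmxZr c B A : B *t (c *: A) = c *: (B *t A).
Proof. by apply/matrixP=> i j; rewrite !mxE mulrCA. Qed.

(** The diagonal of the Kronecker sum of two diagonal matrices. *)
Definition tsum b a : 'rV[R]_(n * m) :=
  \row_k (b 0 (mxtens_unindex k).1 + a 0 (mxtens_unindex k).2).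

Lemma tsumZ c b a : tsum (c *: b) (c *: a) = c *: tsum b a.
Proof. by apply/rowP=> k; rewrite !mxE mulrDr. Qed.

Lemma tsumN b a : tsum (- b) (- a) = - tsum b a.
Proof. by apply/rowP=> k; rewrite !mxE opprD. Qed.

Lemma eq_mxtens_unindex (i j : 'I_(n * m)) : (i == j) =
  ((mxtens_unindex i).1 == (mxtens_unindex j).1) && ((mxtens_unindex i).2 == (mxtens_unindex j).2).
Proof.
rewrite -(inj_eq (can_inj (@mxtens_unindexK n m))).
by case: (mxtens_unindex i) (mxtens_unindex j) => [? ?] [? ?]; rewrite xpair_eqE.
Qed.

Lemma expdiag_tens b a : expdiag b *t expdiag a = expdiag (tsum b a).
Proof.
apply/matrixP=> i j; rewrite !mxE eq_mxtens_unindex expRD.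
by case: eqP => [->|_]; case: eqP => [->|_]; rewrite ?mulr0n ?mulr0 ?mul0r.
Qed.

Lemma diag_mx_tens b a : diag_mx b *t 1%:M + 1%:M *t diag_mx a = diag_mx (tsum b a).
Proof.
apply/matrixP=> i j; rewrite !mxE eq_mxtens_unindex.
by case: eqP => [->|_]; case: eqP => [->|_]; rewrite ?mulr0n ?mulr0 ?mul0r ?mulr1 ?mul1r ?addr0 ?add0r.
Qed.

Lemma congruent_diag_tens Cb b B B' Ca a A A' :
  congruent_diag Cb b B B' -> congruent_diag Ca a A A' ->
  congruent_diag (Cb *t Ca) (tsum b a) (B *t A) (B' *t A').
Proof.
move=> [Cbu -> ->] [Cau -> ->]; split; first exact: tens_unitmx.
  by rewrite trmx_tens tensmx_mul.
by rewrite trmx_tens -expdiag_tens !tensmx_mul.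
Qed.

Lemma tens_orth Q W : Q *m Q^T = 1%:M -> W *m W^T = 1%:M ->
  ((Q : 'M[R]_n) *t (W : 'M[R]_m)) *m (Q *t W)^T = 1%:M.
Proof. by move=> Q1 W1; rewrite trmx_tens tensmx_mul Q1 W1 tensmx11. Qed.

Lemma mxsqrtV_tens B A : spd B -> spd A -> mxsqrtV (B *t A) = mxsqrtV B *t mxsqrtV A.
Proof.
move=> /spd_spectral[Q [b [Q1 ->]]] /spd_spectral[W [a [W1 ->]]].
rewrite !mxsqrtV_expdiag // -!tensmx_mul expdiag_tens -trmx_tens mxsqrtV_expdiag; last exact: tens_orth.
by rewrite -tsumZ -tsumN -expdiag_tens trmx_tens.
Qed.

Lemma tens_diag_tangent Q b W a : Q *m Q^T = 1%:M -> W *m W^T = 1%:M ->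
  (Q *t W)^T *m diag_mx (tsum b a) *m (Q *t W) =
  1%:M *t (W^T *m diag_mx a *m W) + (Q^T *m diag_mx b *m Q) *t 1%:M.
Proof.
move=> Q1 W1; rewrite -diag_mx_tens trmx_tens mulmxDr mulmxDl !tensmx_mul !mulmx1.
by rewrite (mulmx1C Q1) (mulmx1C W1) addrC.
Qed.

Lemma symmetric_spectral k (Q : 'M[R]_k) d : Q^T *m diag_mx d *m Q \is symmetricmx.
Proof. by apply/symmetricmxP; rewrite !trmx_mul trmxK tr_diag_mx mulmxA. Qed.

Lemma tens_diag_kron_tangent Q b W a : Q *m Q^T = 1%:M -> W *m W^T = 1%:M ->
  kron_tangent m n ((Q *t W)^T *m diag_mx (tsum b a) *m (Q *t W)).
Proof.
move=> Q1 W1; rewrite tens_diag_tangent //.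
by do 2!eexists; split; last reflexivity; exact: symmetric_spectral.
Qed.

Lemma kron_spd G : kron_family m n G -> spd G.
Proof.
case=> A [B [/spd_spectral[W [a [W1 ->]]] /spd_spectral[Q [b [Q1 ->]]] ->]].
rewrite -!tensmx_mul expdiag_tens -trmx_tens -{2}(trmxK (Q *t W)); apply: spd_expdiag.
by rewrite tr_unitmx // orth_unitmx // tens_orth.
Qed.

Lemma spdZ k (S : 'M[R]_k) c : 0 < c -> spd S -> spd (c *: S).
Proof.
move=> c0 [/symmetricmxP Ss Sp]; split; first by apply/symmetricmxP; rewrite linearZ /= Ss.
by move=> v v0; rewrite -scalemxAr -scalemxAl mxE mulr_gt0 // Sp.
Qed.

Lemma kron_scale G c : 0 < c -> kron_family m n G -> kron_family m n (c *: G).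
Proof.
move=> c0 [A [B [As Bs ->]]]; exists A, (c *: B); split=> //; first exact: spdZ.
by rewrite tensmxZl.
Qed.

(** Both factors can be diagonalized separately, so a geodesic of the family is
    the tensor product of geodesics of the factors. *)
Lemma kron_geodesic G G' : kron_family m n G -> kron_family m n G' ->
  exists C l, congruent_diag C l G G' /\
    forall t : R, kron_family m n (C *m expdiag (t *: l) *m C^T).
Proof.
move=> [A [B [As Bs ->]]] [A' [B' [As' Bs' ->]]].
have [Ca [a CA]] := congruent_diag_exists As As'.
have [Cb [b CB]] := congruent_diag_exists Bs Bs'.
exists (Cb *t Ca), (tsum b a); split; first exact: congruent_diag_tens.
move=> t; exists (Ca *m expdiag (t *: a) *m Ca^T), (Cb *m expdiag (t *: b) *m Cb^T).
split.
- by apply: spd_expdiag; case: CA.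
- by apply: spd_expdiag; case: CB.
by rewrite -!tensmx_mul trmx_tens expdiag_tens tsumZ.
Qed.

(** Whitening acts factor by factor, and the logarithm of a tensor product is a
    Kronecker sum. *)
Lemma kron_log_tangent G G' : kron_family m n G -> kron_family m n G' ->
  kron_tangent m n (mxlog (whiten G G')).
Proof.
move=> [A [B [As Bs ->]]] [A' [B' [As' Bs' ->]]].
have [Ca [a CA]] := congruent_diag_exists As As'.
have [Cb [b CB]] := congruent_diag_exists Bs Bs'.
rewrite (mxlog_whiten (congruent_diag_tens CB CA)) mxsqrtV_tens // trmx_tens tensmx_mul.
apply: tens_diag_kron_tangent.
  by case: (congruent_diag_whiten CB).
by case: (congruent_diag_whiten CA).
Qed.

Lemma kron_mxlog_tangent G : kron_family m n G -> kron_tangent m n (mxlog G).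
Proof.
case=> A [B [/spd_spectral[W [a [W1 ->]]] /spd_spectral[Q [b [Q1 ->]]] ->]].
rewrite -!tensmx_mul expdiag_tens -trmx_tens mxlog_expdiag; last exact: tens_orth.
exact: tens_diag_kron_tangent.
Qed.

Lemma kron_tangent_exp Z : kron_tangent m n Z ->
  exists (Q : 'M[R]_(n * m)) d, [/\ Q *m Q^T = 1%:M, Z = Q^T *m diag_mx d *m Q &
                  kron_family m n (Q^T *m expdiag d *m Q)].
Proof.
case=> X [Y [/symmetricmxP Xs /symmetricmxP Ys ->]].
have [W [a [W1 ->]]] := spectral_theorem Xs; have [Q [b [Q1 ->]]] := spectral_theorem Ys.
exists (Q *t W), (tsum b a); split; [exact: tens_orth|by rewrite tens_diag_tangent|].
exists (W^T *m expdiag a *m W), (Q^T *m expdiag b *m Q); split.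
- by rewrite -{2}(trmxK W); apply: spd_expdiag; rewrite tr_unitmx ?orth_unitmx.
- by rewrite -{2}(trmxK Q); apply: spd_expdiag; rewrite tr_unitmx ?orth_unitmx.
by rewrite trmx_tens -expdiag_tens !tensmx_mul.
Qed.

Lemma kron_tangent_sym Z : kron_tangent m n Z -> Z^T = Z.
Proof.
case=> X [Y [/symmetricmxP Xs /symmetricmxP Ys ->]].
by rewrite linearD /= !trmx_tens !trmx1 Xs Ys.
Qed.

Lemma kron_tangentB Z Z' : kron_tangent m n Z -> kron_tangent m n Z' ->
  kron_tangent m n (Z - Z').
Proof.
case=> X [Y [/symmetricmxP Xs /symmetricmxP Ys ->]] [X' [Y' [/symmetricmxP Xs' /symmetricmxP Ys' ->]]].
exists (X - X'), (Y - Y'); split.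
- by apply/symmetricmxP; rewrite linearB /= Xs Xs'.
- by apply/symmetricmxP; rewrite linearB /= Ys Ys'.
rewrite -[- X']scaleN1r -[- Y']scaleN1r tensmxDl tensmxDr tensmxZl tensmxZr.
by rewrite !scaleN1r opprD addrACA.
Qed.

End Tensor.

(** * Orthogonal projection onto the tangent space *)

Section PartialTraces.
Context {R : realType} {m n : nat}.
Implicit Types (S T Z : 'M[R]_(n * m)) (X : 'M[R]_m) (Y : 'M[R]_n).

Definition ptr_left S : 'M[R]_m :=
  \matrix_(a, b) \sum_(i < n) S (mxtens_index (i, a)) (mxtens_index (i, b)).
Definition ptr_right S : 'M[R]_n :=
  \matrix_(i, j) \sum_(a < m) S (mxtens_index (i, a)) (mxtens_index (j, a)).

Lemma ptr_leftB S T : ptr_left (S - T) = ptr_left S - ptr_left T.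
Proof.
by apply/matrixP=> a b; rewrite !mxE -sumrB; apply: eq_bigr => i _; rewrite !mxE.
Qed.

Lemma ptr_rightB S T : ptr_right (S - T) = ptr_right S - ptr_right T.
Proof.
by apply/matrixP=> a b; rewrite !mxE -sumrB; apply: eq_bigr => i _; rewrite !mxE.
Qed.

Lemma ptr_left_tangent X Y :
  ptr_left (1%:M *t X + Y *t 1%:M) = n%:R *: X + (\tr Y)%:M.
Proof.
apply/matrixP=> a b; rewrite !mxE.
have -> : n%:R * X a b = \sum_(i < n) X a b by rewrite sumr_const card_ord mulr_natl.
rewrite /mxtrace -sumrMnl -big_split /=; apply: eq_bigr => i _.
by rewrite -[Y i i *+ _]mulr_natr !mxE !mxtens_indexK /= eqxx mul1r.
Qed.

Lemma ptr_right_tangent X Y :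
  ptr_right (1%:M *t X + Y *t 1%:M) = m%:R *: Y + (\tr X)%:M.
Proof.
apply/matrixP=> i j; rewrite !mxE.
have -> : m%:R * Y i j = \sum_(a < m) Y i j by rewrite sumr_const card_ord mulr_natl.
rewrite /mxtrace -sumrMnl -big_split /=; apply: eq_bigr => a _.
by rewrite -[X a a *+ _]mulr_natr !mxE !mxtens_indexK /= eqxx mulr1 addrC [_ * X _ _]mulrC.
Qed.

Lemma mxtrace_ptr S : \tr (ptr_left S) = \tr (ptr_right S).
Proof.
transitivity (\sum_(a < m) \sum_(i < n) S (mxtens_index (i, a)) (mxtens_index (i, a))).
  by apply: eq_bigr => a _; rewrite mxE.
by rewrite exchange_big; apply: eq_bigr => i _; rewrite mxE.
Qed.

(** The partial traces are the adjoints of the two embeddings of the factors, so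
    that a matrix is orthogonal to the tangent space as soon as both its partial
    traces vanish. *)
Lemma frob_dot_tangent S X Y :
  frob_dot S (1%:M *t X + Y *t 1%:M) = frob_dot (ptr_left S) X + frob_dot (ptr_right S) Y.
Proof.
rewrite frob_dotDr; congr (_ + _); rewrite !frob_dotE.
- transitivity (\sum_(i < n) \sum_(a < m) \sum_(b < m)
      S (mxtens_index (i, a)) (mxtens_index (i, b)) * X a b).
    rewrite big_mxtens; apply: eq_bigr => i _; apply: eq_bigr => a _.
    rewrite big_mxtens (bigD1 i) //= [X in _ + X]big1 ?addr0.
      by apply: eq_bigr => b _; rewrite tensmxE mxE eqxx mul1r.
    by move=> j /negPf ji; apply: big1 => b _; rewrite tensmxE mxE eq_sym ji mul0r mulr0.
  rewrite exchange_big; apply: eq_bigr => a _; rewrite exchange_big; apply: eq_bigr => b _ /=.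
  by rewrite mxE mulr_suml.
- transitivity (\sum_(i < n) \sum_(a < m) \sum_(j < n)
      S (mxtens_index (i, a)) (mxtens_index (j, a)) * Y i j).
    rewrite big_mxtens; apply: eq_bigr => i _; apply: eq_bigr => a _.
    rewrite big_mxtens; apply: eq_bigr => j _; rewrite (bigD1 a) //= [X in _ + X]big1 ?addr0.
      by rewrite tensmxE [1%:M _ _]mxE eqxx mulr1.
    by move=> b /negPf ba; rewrite tensmxE [1%:M _ _]mxE eq_sym ba !mulr0.
  apply: eq_bigr => i _; rewrite exchange_big; apply: eq_bigr => j _ /=.
  by rewrite mxE mulr_suml.
Qed.

Lemma tangent_proj_exists S : (0 < m)%N -> (0 < n)%N -> S^T = S ->
  exists P, kron_tangent m n P /\ forall Z, kron_tangent m n Z -> frob_dot (S - P) Z = 0.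
Proof.
move=> m0 n0 Ss.
have m1 : m%:R != 0 :> R by rewrite pnatr_eq0 -lt0n.
have n1 : n%:R != 0 :> R by rewrite pnatr_eq0 -lt0n.
(* Averaged partial traces; the trace of S is recorded by both of them, so it is
   removed from one. *)
pose X : 'M[R]_m := n%:R^-1 *: ptr_left S.
pose Y : 'M[R]_n := m%:R^-1 *: ptr_right S - (\tr (ptr_left S) / (m%:R * n%:R))%:M.
have Xs : X^T = X.
  apply/matrixP=> a b; rewrite !mxE; congr (_ * _); apply: eq_bigr => i _.
  by rewrite -[in LHS]Ss mxE.
have Ys : Y^T = Y.
  apply/matrixP=> i j; rewrite !mxE eq_sym; congr (_ * _ - _); apply: eq_bigr => a _.
  by rewrite -[in LHS]Ss mxE.
exists (1%:M *t X + Y *t 1%:M); split.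
  by exists X, Y; split=> //; apply/symmetricmxP.
have trY : \tr Y = 0.
  rewrite /Y linearB linearZ /= mxtrace_scalar -mxtrace_ptr -mulr_natr.
  by field; rewrite m1 n1.
have trX : \tr X = \tr (ptr_left S) / n%:R by rewrite /X linearZ /= mulrC.
move=> _ [X' [Y' [_ _ ->]]]; rewrite frob_dot_tangent ptr_leftB ptr_rightB.
rewrite ptr_left_tangent ptr_right_tangent trY trX.
have -> : ptr_left S - (n%:R *: X + 0%:M) = 0.
  by rewrite /X scalerA mulfV // scale1r raddf0 addr0 subrr.
have -> : ptr_right S - (m%:R *: Y + (\tr (ptr_left S) / n%:R)%:M) = 0.
  rewrite /Y scalerBr scalerA mulfV // scale1r scale_scalar_mx.
  have -> : m%:R * (\tr (ptr_left S) / (m%:R * n%:R)) = \tr (ptr_left S) / n%:R.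
    by field; rewrite m1 n1.
  by rewrite subrK subrr.
by rewrite -(scale0r (0 : 'M[R]_m)) -(scale0r (0 : 'M[R]_n)) !frob_dotZl !mul0r addr0.
Qed.

Lemma tangent_projP S : (0 < m)%N -> (0 < n)%N -> S^T = S ->
  kron_tangent m n (tangent_proj S) /\
  forall Z, kron_tangent m n Z -> frob_dot (S - tangent_proj S) Z = 0.
Proof.
move=> m0 n0 Ss; apply: (@xgetPex _ 0 (fun P => kron_tangent m n P /\
  forall Z, kron_tangent m n Z -> frob_dot (S - P) Z = 0)).
exact: tangent_proj_exists.
Qed.

End PartialTraces.

(** * Existence of the nearest point *)

Section ExpLipschitz.
Context {R : realType} {N : nat}.
Implicit Types (Z W : 'M[R]_N).

Definition mxexp Z : 'M[R]_N := mxfun (@expR R) Z.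

Lemma mxexpE (Q : 'M[R]_N) d : Q *m Q^T = 1%:M ->
  mxexp (Q^T *m diag_mx d *m Q) = Q^T *m expdiag d *m Q.
Proof. exact: mxfunE. Qed.

Opaque mxexp tangent_proj.

Lemma mxexp_spd Z : Z^T = Z -> spd (mxexp Z).
Proof.
move=> /spectral_theorem[Q [d [Q1 ->]]]; rewrite mxexpE // -{2}(trmxK Q).
by apply: spd_expdiag; rewrite tr_unitmx ?orth_unitmx.
Qed.

Lemma mxlogK G : spd G -> mxexp (mxlog G) = G.
Proof.
by move=> /spd_spectral[Q [d [Q1 ->]]]; rewrite mxlog_expdiag // mxexpE.
Qed.

Lemma eigenvalue_le_frob (Q : 'M[R]_N) (d : 'rV[R]_N) i : Q *m Q^T = 1%:M ->
  `|d 0 i| <= frob (Q^T *m diag_mx d *m Q).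
Proof.
move=> Q1; rewrite frob_orth // -(@ler_pXn2r _ 2) ?nnegrE ?frob_ge0 //.
rewrite frob_diag real_normK ?num_real // (bigD1 i) //= lerDl.
by apply: sumr_ge0 => j _; exact: sqr_ge0.
Qed.

(** All differences of eigenvalues of W and Z are at most |Z| + |W|, so the
    comparison of J with the logarithms applies with this bound. *)
Lemma dAI_mxexp_le Z W : Z^T = Z -> W^T = W ->
  dAI (mxexp Z) (mxexp W) <= expR (frob Z + frob W) * frob (Z - W).
Proof.
move=> Zs Ws; rewrite -(@ler_pXn2r _ 2) ?nnegrE ?dAI_ge0 ?mulr_ge0 ?expR_ge0 ?frob_ge0 //.
apply: le_trans (dAI_sqr_le_jeffreys (mxexp_spd Zs) (mxexp_spd Ws)) _.
have L0 : 0 <= frob Z + frob W by rewrite addr_ge0 ?frob_ge0.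
rewrite exprMn; apply: le_trans (_ : expR (frob Z + frob W) * frob (Z - W) ^+ 2 <= _); last first.
  by rewrite ler_wpM2r ?sqr_ge0 // -expRM_natl ler_expR; lra.
have [Q [a [Q1 ZE]]] := spectral_theorem Zs; have [V [b [V1 WE]]] := spectral_theorem Ws.
have aZ i : `|a 0 i| <= frob Z by rewrite ZE; exact: eigenvalue_le_frob.
have bW i : `|b 0 i| <= frob W by rewrite WE; exact: eigenvalue_le_frob.
rewrite {1}ZE {1}WE !mxexpE // {2}ZE {2}WE; apply: jeffreys_le => // i j.
by apply: le_trans (ler_normB _ _) _; rewrite addrC lerD.
Qed.

End ExpLipschitz.

Section Minimizer.
Context {R : realType} {m n : nat}.
Hypotheses (m0 : (0 < m)%N) (n0 : (0 < n)%N).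
Implicit Types (G H S Z : 'M[R]_(n * m)).

Lemma tangent_proj_contract S S' : S^T = S -> S'^T = S' ->
  frob (tangent_proj S - tangent_proj S') <= frob (S - S').
Proof.
move=> Ss Ss'; have [P1 P2] := tangent_projP m0 n0 Ss; have [P1' P2'] := tangent_projP m0 n0 Ss'.
set P := tangent_proj S in P1 P2 *; set P' := tangent_proj S' in P1' P2' *.
have PP := kron_tangentB P1 P1'.
have e : frob (P - P') ^+ 2 = frob_dot (S - S') (P - P').
  move: (P2 _ PP) (P2' _ PP); rewrite frob_sqr !frob_dotBl => /eqP h1 /eqP h2.
  by move: h1 h2; rewrite !subr_eq0 => /eqP -> /eqP ->.
have := frob_CauchySchwarz (S - S') (P - P'); rewrite -e expr2.
have [->|d0] := eqVneq (frob (P - P')) 0; first by rewrite frob_ge0.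
by rewrite ler_pM2r // lt_neqAle eq_sym d0 frob_ge0.
Qed.

Lemma tangent_proj_id Z : kron_tangent m n Z -> tangent_proj Z = Z.
Proof.
move=> ZL; have [P1 P2] := tangent_projP m0 n0 (kron_tangent_sym ZL).
apply/esym/eqP; rewrite -subr_eq0; apply/eqP/frob_eq0.
by rewrite /frob P2 ?sqrtr0 //; exact: kron_tangentB.
Qed.

Lemma le_mx_norm_row k (v : 'rV[R]_k) i : `|v 0 i| <= `|v|.
Proof.
have /mapP[j Hj ->] : `|v 0 i| \in [seq `|v x.1 x.2| | x : 'I_1 * 'I_k].
  by apply/mapP; exists (0, i) => //=; rewrite mem_enum.
by rewrite [leRHS]/Num.norm /= mx_normrE; apply/bigmax_geP; right => /=; exists j.
Qed.

Lemma frob_vec_mx (v : 'rV[R]_((n * m) * (n * m))) :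
  frob (vec_mx v) <= (n * m)%:R * `|v|.
Proof.
rewrite -(@ler_pXn2r _ 2) ?nnegrE ?frob_ge0 ?mulr_ge0 ?normr_ge0 //.
rewrite frob_sqr frob_dotE; apply: le_trans (_ : \sum_(i < n * m) \sum_(j < n * m) `|v| ^+ 2 <= _).
  apply: ler_sum => i _; apply: ler_sum => j _.
  rewrite -expr2 mxE -[_ ^+ 2]real_normK ?num_real //.
  by rewrite ler_pXn2r ?nnegrE // le_mx_norm_row.
rewrite !sumr_const !card_ord; move: `|v| => x; move: (n * m)%N => k.
by rewrite -mulrnA -[leLHS]mulr_natl natrM exprMn expr2.
Qed.

Lemma le_frob (S : 'M[R]_(n * m)) i j : `|S i j| <= frob S.
Proof.
rewrite -(@ler_pXn2r _ 2) ?nnegrE ?frob_ge0 // real_normK ?num_real //.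
rewrite frob_sqr frob_dotE (bigD1 i) //= (bigD1 j) //= -expr2 -addrA lerDl.
rewrite addr_ge0 //; first by apply: sumr_ge0 => k _; rewrite -expr2 sqr_ge0.
by apply: sumr_ge0 => k _; apply: sumr_ge0 => l _; rewrite -expr2 sqr_ge0.
Qed.

Definition sympart S : 'M[R]_(n * m) := 2^-1 *: (S + S^T).

Lemma sympart_sym S : (sympart S)^T = sympart S.
Proof. by rewrite /sympart linearZ /= linearD /= trmxK addrC. Qed.

Lemma sympart_id S : S^T = S -> sympart S = S.
Proof. by move=> e; apply/matrixP=> i j; rewrite /sympart e !mxE; field. Qed.

Lemma sympartB S T : sympart S - sympart T = sympart (S - T).
Proof. by apply/matrixP=> i j; rewrite !mxE; field. Qed.

Lemma frob_tr S : frob S^T = frob S.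
Proof. by rewrite /frob /frob_dot trmxK mxtrace_mulC. Qed.

Lemma frob_sympart S : frob (sympart S) <= frob S.
Proof.
rewrite frobZ ger0_norm ?invr_ge0 //; have := frob_triangle S S^T; rewrite frob_tr.
by move=> h; lra.
Qed.

(* A Lipschitz retraction of all matrices, stored as row vectors, onto the
   tangent space: it lets one minimize over a compact box of row vectors. *)
Let tangent_of (v : 'rV[R]_((n * m) * (n * m))) := tangent_proj (sympart (vec_mx v)).

Lemma tangent_ofP v : kron_tangent m n (tangent_of v).
Proof. by case: (tangent_projP m0 n0 (sympart_sym (vec_mx v))). Qed.

Lemma tangent_of_lipschitz v w :
  frob (tangent_of v - tangent_of w) <= (n * m)%:R * `|v - w|.
Proof.
apply: le_trans (tangent_proj_contract (sympart_sym _) (sympart_sym _)) _.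
rewrite sympartB -linearB /=; apply: le_trans (frob_sympart _) _; exact: frob_vec_mx.
Qed.

Lemma kron_exp Z : kron_tangent m n Z -> kron_family m n (mxexp Z).
Proof. by case/kron_tangent_exp=> Q [d [Q1 -> Gk]]; rewrite mxexpE. Qed.

(** The distance to H is 1-Lipschitz and the exponential is locally Lipschitz. *)
Lemma continuous_dAI_tangent H : spd H ->
  continuous (fun v : 'rV[R]_((n * m) * (n * m)) => dAI H (mxexp (tangent_of v)) : R).
Proof.
move=> Hs v; pose Nr : R := (n * m)%:R; have N0 : 0 <= Nr by exact: ler0n.
pose L := frob (tangent_of v) + (frob (tangent_of v) + Nr).
pose c := expR L * Nr + 1; have c0 : 0 < c.
  by rewrite ltr_wpDl // mulr_ge0 ?expR_ge0.
have FF : Filter (nbhs v) := nbhs_filter v.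
apply/cvgrPdist_lt => e e0.
suff : \forall w \near v, `|dAI H (mxexp (tangent_of v)) - dAI H (mxexp (tangent_of w))| < e by [].
apply/nbhs_normP; exists (Num.min 1 (e / c)); first by rewrite /= lt_min ltr01 divr_gt0.
move=> w; rewrite /= lt_min => /andP[vw1 vwe].
have sv := kron_tangent_sym (tangent_ofP v); have sw := kron_tangent_sym (tangent_ofP w).
have lip := tangent_of_lipschitz v w.
have d : dAI (mxexp (tangent_of v)) (mxexp (tangent_of w)) < e.
  apply: le_lt_trans (dAI_mxexp_le sv sw) _.
  apply: le_lt_trans (_ : c * `|v - w| < e); last by rewrite mulrC -ltr_pdivlMr.
  have fw : frob (tangent_of w) <= frob (tangent_of v) + Nr.
    have := frob_triangle (tangent_of v) (- (tangent_of v - tangent_of w)).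
    rewrite opprB addrC subrK -[frob (tangent_of w - _)]frobN opprB => h.
    apply: le_trans h _; rewrite lerD2l; apply: le_trans lip _.
    by rewrite -[leRHS]mulr1 ler_wpM2l // ltW.
  apply: le_trans (_ : expR L * (Nr * `|v - w|) <= _).
    apply: ler_pM; rewrite ?expR_ge0 ?frob_ge0 //.
    by rewrite ler_expR /L lerD2l.
  by rewrite mulrA ler_wpM2r ?normr_ge0 // lerDl.
have vs := mxexp_spd sv; have ws := mxexp_spd sw.
exact: le_lt_trans (dist_dAI_le Hs vs ws) d.
Qed.

(** A point G of the family no further from H than the identity has its logarithm
    within distance f 0 of that of H, by the metric inequality; so the minimum
    over a large enough box is global. *)
Lemma kron_proj_exists H : spd H ->
  exists P, kron_family m n P /\ forall G, kron_family m n G -> dAI H P <= dAI H G.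
Proof.
move=> Hs; pose f v := dAI H (mxexp (tangent_of v)).
pose r := frob (mxlog H) + f 0.
have r0 : 0 <= r by rewrite addr_ge0 ?frob_ge0 ?dAI_ge0.
pose A := [set v : 'rV[R]_((n * m) * (n * m)) | forall i, v ord0 i \in `[- r, r]].
have A0 : A 0 by move=> i; rewrite mxE in_itv /= r0 andbT lerNl oppr0.
have cA : compact A.
  apply: (@rV_compact _ _ (fun=> `[- r, r]%classic)) => _; exact: segment_compact.
have [c cA' cmin] : exists2 c, c \in A & forall t, t \in A -> f c <= f t.
  apply: EVT_min_rV => //; first by exists 0.
  exact/continuous_subspaceT/continuous_dAI_tangent.
exists (mxexp (tangent_of c)); split; first exact/kron_exp/tangent_ofP.
move=> G Gk; have Gs := kron_spd Gk.
have le_or_lt (x y : R) : x <= y \/ y < x by case: leP; [left|right].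
have [fG|Gf] := le_or_lt (f 0) (dAI H G).
  by apply: le_trans (cmin 0 _) fG; rewrite inE.
have ZL := kron_mxlog_tangent Gk; have Zs := kron_tangent_sym ZL.
set Z := mxlog G in ZL Zs.
have Zr : frob Z <= r.
  have := frob_triangle (mxlog H) (- (mxlog H - Z)); rewrite opprB addrC subrK.
  move=> /le_trans; apply; rewrite /r lerD2l -frobN opprB.
  apply: le_trans (exponential_metric_increasing Hs Gs) (ltW Gf).
have -> : G = mxexp (tangent_of (mxvec Z)).
  by rewrite /tangent_of mxvecK sympart_id // tangent_proj_id // mxlogK.
apply: cmin; rewrite inE => k; case/mxvec_indexP: k => i j.
by rewrite mxvecE in_itv /= -ler_norml (le_trans (le_frob _ _ _)).
Qed.

Lemma kron_projP H : spd H -> kron_family m n (kron_proj H) /\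
  forall G, kron_family m n G -> dAI H (kron_proj H) <= dAI H G.
Proof.
move=> Hs; apply: (@xgetPex _ 0 (fun P => kron_family m n P /\
  forall G, kron_family m n G -> dAI H P <= dAI H G)).
exact: kron_proj_exists.
Qed.

End Minimizer.

(** * Spread of the logarithmic spectrum *)

Section Spread.
Context {R : realType}.
Implicit Types (r a : R).

Lemma mul_subn_le_sqr4 k N : (k <= N)%N -> (k * (N - k) <= N ^ 2 %/ 4)%N.
Proof.
move=> kN; rewrite leq_divRL // -{2}(subnKC kN) mulnC.
exact: leq_of_leqif (nat_AGM2 _ _).
Qed.

(** The quantity N sum x^2 - (sum x)^2 is convex in each x, so moving the entries
    one after the other to a suitable end of [0, r] can only increase it until all of
    them are at the ends; with k of them at r it equals k (N - k) r^2.  In the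
    induction, k counts the entries already moved to r. *)
Lemma spread_seq (N : nat) r (s : seq R) k : 0 <= r -> (k + size s <= N)%N ->
  all (fun x => 0 <= x <= r) s ->
  N%:R * (k%:R * r ^+ 2 + \sum_(x <- s) x ^+ 2) - (k%:R * r + \sum_(x <- s) x) ^+ 2
    <= (N ^ 2 %/ 4)%:R * r ^+ 2.
Proof.
move=> r0; elim: s k => [|u s IHs] k.
  rewrite addn0 => kN _; rewrite !big_nil !addr0 exprMn mulrA -mulrBl ler_wpM2r ?sqr_ge0 //.
  rewrite expr2 -mulrBl mulrC -natrB // -natrM ler_nat.
  exact: mul_subn_le_sqr4.
rewrite /= addnS => kN /andP[/andP[u0 ur] sr].
have := IHs k (ltnW kN) sr; have := IHs k.+1 kN sr; rewrite -natr1 !big_cons.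
have N1 : 1 <= N%:R :> R by rewrite ler1n (leq_trans _ kN).
move: (\sum_(x <- s) x ^+ 2) (\sum_(x <- s) x) (_%:R * r ^+ 2) => S2 S1 B.
move: N%:R k%:R N1 => n j n1 h1 h0.
have [r_eq0|r_neq0] := eqVneq r 0.
  have -> : u = 0 by apply/eqP; rewrite eq_le u0 -{1}r_eq0 ur.
  by rewrite expr0n /= !add0r.
have r_gt0 : 0 < r by rewrite lt_neqAle eq_sym r_neq0.
rewrite -(ler_pM2l r_gt0).
have h0' : (r - u) * (n * (j * r ^+ 2 + S2) - (j * r + S1) ^+ 2) <= (r - u) * B.
  by rewrite ler_wpM2l // subr_ge0.
have h1' : u * (n * ((j + 1) * r ^+ 2 + S2) - ((j + 1) * r + S1) ^+ 2) <= u * B.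
  by rewrite ler_wpM2l.
(* The gap between the chord over [0, r] and the convex function of u. *)
have cv : 0 <= (n - 1) * (u * (r * (r - u))) by rewrite !mulr_ge0 ?subr_ge0.
rewrite -subr_ge0; apply: le_trans (_ : 0 <= ((r - u) * B
   - (r - u) * (n * (j * r ^+ 2 + S2) - (j * r + S1) ^+ 2)) + (u * B
   - u * (n * ((j + 1) * r ^+ 2 + S2) - ((j + 1) * r + S1) ^+ 2))
   + (n - 1) * (u * (r * (r - u)))) _.
  by apply: addr_ge0 => //; apply: addr_ge0; rewrite subr_ge0.
rewrite le_eqVlt; apply/orP; left; apply/eqP; ring.
Qed.

Lemma sum_sqr_shift N (l : 'I_N -> R) a :
  N%:R * (\sum_i (l i - a) ^+ 2) - (\sum_i (l i - a)) ^+ 2 =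
  N%:R * (\sum_i l i ^+ 2) - (\sum_i l i) ^+ 2.
Proof.
have -> : \sum_i (l i - a) ^+ 2 = \sum_i l i ^+ 2 - 2 * a * (\sum_i l i) + N%:R * a ^+ 2.
  have -> : N%:R * a ^+ 2 = \sum_(i < N) a ^+ 2 by rewrite sumr_const card_ord mulr_natl.
  rewrite mulr_sumr -sumrB -big_split; apply: eq_bigr => i _ /=; ring.
have -> : \sum_i (l i - a) = \sum_i l i - N%:R * a.
  by rewrite sumrB sumr_const card_ord mulr_natl.
ring.
Qed.

Lemma centered_spread N (l : 'I_N -> R) a r : (0 < N)%N -> 0 <= r ->
  (forall i, a <= l i <= a + r) ->
  N%:R * (\sum_i (l i - (\sum_j l j) / N%:R) ^+ 2) <= (N ^ 2 %/ 4)%:R * r ^+ 2.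
Proof.
move=> N0 r0 lr.
have -> : N%:R * (\sum_i (l i - (\sum_j l j) / N%:R) ^+ 2) =
    N%:R * (\sum_i (l i - a) ^+ 2) - (\sum_i (l i - a)) ^+ 2.
  rewrite sum_sqr_shift -(sum_sqr_shift l ((\sum_j l j) / N%:R)).
  have -> : \sum_i (l i - (\sum_j l j) / N%:R) = 0.
    rewrite sumrB sumr_const card_ord -[X in _ - X]mulr_natr divfK ?subrr //.
    by rewrite pnatr_eq0 -lt0n.
  by rewrite expr0n subr0.
have sumE F : \sum_(x <- [seq l i - a | i <- enum 'I_N]) F x = \sum_i F (l i - a) :> R.
  by rewrite big_map enumT; apply: eq_bigl.
have := @spread_seq N r [seq l i - a | i <- enum 'I_N] 0 r0.
rewrite size_map size_enum_ord !sumE !mul0r !add0r; apply => //.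
apply/allP => _ /mapP[i _ ->]; have /andP[h1 h2] := lr i.
by rewrite subr_ge0 h1 lerBlDl.
Qed.

End Spread.

(** * Condition number of the generalized eigenvalue problem *)

Section GeneralizedCondition.
Context {R : realType} {N : nat}.
Implicit Types (C G H P S : 'M[R]_N) (l : 'rV[R]_N) (v : 'cV[R]_N).

Definition quad S v : R := (v^T *m S *m v) 0 0.

Lemma quad_congr C S v : quad (C *m S *m C^T) v = quad S (C^T *m v).
Proof. by rewrite /quad trmx_mul trmxK !mulmxA. Qed.

Lemma quad_expdiag l v : quad (expdiag l) v = \sum_i expR (l 0 i) * v i 0 ^+ 2.
Proof.
rewrite /quad mul_mx_diag mxE; apply: eq_bigr => i _.
by rewrite !mxE mulrAC expr2 mulrC.
Qed.

Lemma quad_bounds C l G H a b v : congruent_diag C l G H ->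
  (forall i, a <= l 0 i <= b) -> expR a * quad G v <= quad H v <= expR b * quad G v.
Proof.
move=> [_ -> ->] lab; rewrite quad_congr quad_expdiag.
have -> : quad (C *m C^T) v = \sum_i (C^T *m v) i 0 ^+ 2.
  rewrite -{1}(mulmx1 C) -expdiag0 quad_congr quad_expdiag.
  by apply: eq_bigr => i _; rewrite mxE expR0 mul1r.
rewrite !mulr_sumr; apply/andP; split; apply: ler_sum => i _;
  by rewrite ler_wpM2r ?sqr_ge0 // ler_expR; case/andP: (lab i).
Qed.

Lemma eigenvector_quad C l G H i : congruent_diag C l G H ->
  exists v, [/\ v != 0, H *m v = expR (l 0 i) *: (G *m v) & quad H v = expR (l 0 i) * quad G v].
Proof.
move=> [Cu -> ->]; have Ctu := tr_unitmx Cu.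
exists (invmx C^T *m delta_mx i 0); split.
- apply/eqP => /(congr1 (mulmx C^T)); rewrite mulKVmx // mulmx0 => /matrixP/(_ i 0)/eqP.
  by rewrite !mxE !eqxx oner_eq0.
- rewrite -!mulmxA mulKVmx // scalemxAr; congr (_ *m _).
  apply/matrixP=> j k; rewrite mul_diag_mx !mxE ord1.
  by case: eqP => [->|]; rewrite ?andbF ?mulr0.
- rewrite /quad -[_ *m (C *m _ *m _) *m _]mulmxA -[_ *m (C *m _) *m _]mulmxA.
  rewrite -!mulmxA mulKVmx //.
  have -> : expdiag l *m delta_mx i 0 = expR (l 0 i) *: delta_mx i 0 :> 'cV[R]_N.
    apply/matrixP=> j k; rewrite mul_diag_mx !mxE ord1.
    by case: eqP => [->|]; rewrite ?andbF ?mulr0.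
  by rewrite -!scalemxAr mxE.
Qed.

Lemma gen_eigenvaluesE C l G H : congruent_diag C l G H ->
  gen_eigenvalues G H = [set x | exists i, x = expR (l 0 i)].
Proof.
move=> CGH; apply/seteqP; split=> x /=; last first.
  by case=> i ->; have [v [v0 Hv _]] := eigenvector_quad i CGH; exists v.
case: CGH => Cu -> -> [v v0]; rewrite -!mulmxA scalemxAr => /(can_inj (mulKmx Cu)).
have : C^T *m v != 0.
  apply: contra v0 => /eqP/(congr1 (mulmx (invmx C^T))).
  by rewrite mulKmx ?tr_unitmx // mulmx0 => ->.
move: (C^T *m v) => w w0 ew.
have [i wi] : exists i, w i 0 != 0.
  apply/existsP; apply: contraR w0; rewrite negb_exists => /forallP w0.
  by apply/eqP/matrixP=> i j; rewrite ord1 [RHS]mxE; apply/eqP; rewrite -[_ == _]negbK.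
exists i; move/matrixP/(_ i 0): ew; rewrite mul_diag_mx !mxE => /(mulIf wi) ->.
by [].
Qed.

Lemma gen_condE C l G H : (0 < N)%N -> congruent_diag C l G H ->
  exists p q, (forall i, l 0 q <= l 0 i <= l 0 p) /\ gen_cond G H = expR (l 0 p - l 0 q).
Proof.
move=> N0 CGH; pose i0 := Ordinal N0.
pose p := [arg max_(i > i0) l 0 i]%O; pose q := [arg min_(i < i0) l 0 i]%O.
have pP i : l 0 i <= l 0 p by rewrite /p; case: arg_maxP => // j _; apply.
have qP i : l 0 q <= l 0 i by rewrite /q; case: arg_minP => // j _; apply.
exists p, q; split; first by move=> i; rewrite pP qP.
rewrite /gen_cond (gen_eigenvaluesE CGH) expRD expRN; congr (_ / _).
- apply/eqP; rewrite eq_le; apply/andP; split.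
    by apply: ge_sup; [exists (expR (l 0 p)), p|move=> _ [i ->]; rewrite ler_expR].
  apply: ub_le_sup; last by exists p.
  by exists (expR (l 0 p)) => _ [i ->]; rewrite ler_expR.
- apply/eqP; rewrite eq_le; apply/andP; split; last first.
    by apply: lb_le_inf; [exists (expR (l 0 q)), q|move=> _ [i ->]; rewrite ler_expR].
  apply: ge_inf; last by exists q.
  by exists (expR (l 0 q)) => _ [i ->]; rewrite ler_expR.
Qed.

Lemma congruent_diag_le_dAI C l G H i : congruent_diag C l G H -> - dAI G H <= l 0 i <= dAI G H.
Proof.
move=> CGH; rewrite -ler_norml -(@ler_pXn2r _ 2) ?nnegrE ?dAI_ge0 //.
rewrite (dAI_sqr CGH) real_normK ?num_real // (bigD1 i) //= lerDl.
by apply: sumr_ge0 => j _; exact: sqr_ge0.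
Qed.

(** The quadratic forms of G and P differ by a factor between e^-e and e^e, which
    moves each of the two extreme generalized eigenvalues by at most such a
    factor. *)
Lemma gen_cond_le G P H (e : R) : (0 < N)%N -> spd G -> spd P -> spd H ->
  dAI G P <= e -> gen_cond P H <= expR (2 * e) * gen_cond G H.
Proof.
move=> N0 Gs Ps Hs de.
have [CG [g CGH]] := congruent_diag_exists Gs Hs.
have [CP [h CPH]] := congruent_diag_exists Ps Hs.
have [C [l CGP]] := congruent_diag_exists Gs Ps.
have [p [q [_ ->]]] := gen_condE N0 CPH; have [r [s [grs ->]]] := gen_condE N0 CGH.
have le i : - e <= l 0 i <= e.
  have /andP[h1 h2] := congruent_diag_le_dAI i CGP.
  by rewrite (le_trans h2 de) (le_trans _ h1) // lerN2.
have P_gt0 v : v != 0 -> 0 < quad P v by move=> v0; case: Ps => _ /(_ v v0).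
rewrite -expRD ler_expR.
have hp : h 0 p <= g 0 r + e.
  have [v [v0 _ hv]] := eigenvector_quad p CPH.
  have /andP[_ b1] := quad_bounds v CGH grs; have /andP[b2 _] := quad_bounds v CGP le.
  rewrite -ler_expR -(ler_pM2r (P_gt0 v v0)) -hv (le_trans b1) //.
  rewrite expRD -mulrA ler_pM2l ?expR_gt0 // -(ler_pM2l (expR_gt0 (- e))) mulrA -expRD.
  by rewrite addNr expR0 mul1r.
have hq : g 0 s - e <= h 0 q.
  have [v [v0 _ hv]] := eigenvector_quad q CPH.
  have /andP[b1 _] := quad_bounds v CGH grs; have /andP[_ b2] := quad_bounds v CGP le.
  rewrite -ler_expR -(ler_pM2r (P_gt0 v v0)) -hv (le_trans _ b1) //.
  rewrite expRD -mulrA ler_pM2l ?expR_gt0 // -(ler_pM2l (expR_gt0 e)) mulrA -expRD.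
  by rewrite subrr expR0 mul1r.
by lra.
Qed.

End GeneralizedCondition.

(** * Soundness of the tests *)

Section Certificates.
Context {R : realType} {m n : nat}.
Hypotheses (m0 : (0 < m)%N) (n0 : (0 < n)%N).
Implicit Types (G H P : 'M[R]_(n * m)).

Lemma mxlog_whiten_sym G H : spd G -> spd H ->
  (mxlog (whiten G H))^T = mxlog (whiten G H).
Proof.
move=> Gs Hs; have [C [l CGH]] := congruent_diag_exists Gs Hs.
by rewrite (mxlog_whiten CGH); apply/symmetricmxP; exact: symmetric_spectral.
Qed.

(** Log_G G' is tangent, so only the tangent part of Log_G H enters the inner
    product; apply Cauchy-Schwarz to it. *)
Lemma kron_law_of_cosines G G' H : kron_family m n G -> kron_family m n G' -> spd H ->
  dAI G H ^+ 2 + dAI G G' ^+ 2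
    - 2 * (frob (tangent_proj (mxlog (whiten G H))) * dAI G G') <= dAI G' H ^+ 2.
Proof.
move=> Gk Gk' Hs; have Gs := kron_spd Gk; have Gs' := kron_spd Gk'.
apply: le_trans (law_of_cosines Gs Gs' Hs).
have ZL := kron_log_tangent Gk Gk'.
have [_ orth] := tangent_projP m0 n0 (mxlog_whiten_sym Gs Hs).
have := frob_CauchySchwarz (tangent_proj (mxlog (whiten G H))) (mxlog (whiten G G')).
have /eqP := orth _ ZL; rewrite frob_dotBl subr_eq0 => /eqP <-.
by rewrite -dAI_frob lerD2l lerN2 ler_pM2l.
Qed.

Lemma dAI_family_ge G G' H : kron_family m n G -> kron_family m n G' -> spd H ->
  dAI H G ^+ 2 - frob (tangent_proj (mxlog (whiten G H))) ^+ 2 <= dAI G' H ^+ 2.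
Proof.
move=> Gk Gk' Hs; apply: le_trans (kron_law_of_cosines Gk Gk' Hs).
rewrite (dAI_sym Hs (kron_spd Gk)); move: (dAI G H ^+ 2) (dAI G G') (frob _) => r d e.
have := sqr_ge0 (d - e); rewrite sqrrB -mulr_natl; lra.
Qed.

(** Adding the Pythagorean inequality at the nearest point to the law of cosines
    at G leaves d^2 <= eta d for d the distance between the two points. *)
Lemma dAI_kron_proj_le G H : kron_family m n G -> spd H ->
  dAI G (kron_proj H) <= frob (tangent_proj (mxlog (whiten G H))).
Proof.
move=> Gk Hs; have [Pk Pmin] := kron_projP m0 n0 Hs.
have Gs := kron_spd Gk; have Ps := kron_spd Pk.
have [C [l [CPG geo]]] := kron_geodesic Pk Gk.
have pyth := pythagoras CPG Hs (fun t => Pmin _ (geo t)).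
have cos := kron_law_of_cosines Gk Pk Hs.
rewrite (dAI_sym Hs Ps) (dAI_sym Hs Gs) (dAI_sym Ps Gs) in pyth.
have := dAI_ge0 G (kron_proj H); have := frob_ge0 (tangent_proj (mxlog (whiten G H))).
move: pyth cos; set e := frob _; set d := dAI G _.
move: (dAI _ H ^+ 2) (dAI G H ^+ 2) e d => p g e d pyth cos e0.
rewrite le_eqVlt => /orP[/eqP <- //|d0].
by rewrite -(ler_pM2r d0) -expr2; lra.
Qed.

(** The scale c is chosen so that the logarithms of the generalized eigenvalues
    of (cG', H) have mean 0, the case in which the spread inequality bounds the
    distance by the condition number; scaling leaves the latter unchanged. *)
Lemma gen_cond_ge_dist G' H (r : R) : kron_family m n G' -> spd H ->
  (forall c, 0 < c -> r <= dAI (c *: G') H ^+ 2) ->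
  expR (Num.sqrt ((m * n)%:R / ((m * n) ^ 2 %/ 4)%:R) * Num.sqrt (Num.max r 0)) <= gen_cond G' H.
Proof.
move=> Gk' Hs hr; have Gs' := kron_spd Gk'.
have N0 : (0 < n * m)%N by rewrite muln_gt0 n0.
have [C [l CGH]] := congruent_diag_exists Gs' Hs.
have [p [q [lpq ->]]] := gen_condE N0 CGH.
rewrite mulnC; set N := (n * m)%N in N0 C l CGH p q lpq *.
pose mu := (\sum_j l 0 j) / N%:R.
have w0 : 0 <= l 0 p - l 0 q by rewrite subr_ge0; case/andP: (lpq p).
have sp : N%:R * (\sum_i (l 0 i - mu) ^+ 2) <= (N ^ 2 %/ 4)%:R * (l 0 p - l 0 q) ^+ 2.
  by apply: (@centered_spread _ _ _ (l 0 q)) => // i; rewrite addrC subrK.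
have scaled : congruent_diag (expR (mu / 2) *: C) (l - const_mx mu) (expR mu *: G') H.
  case: CGH => Cu -> ->.
  have CT : (expR (mu / 2) *: C)^T = expR (mu / 2) *: C^T by apply/matrixP=> i j; rewrite !mxE.
  split; rewrite ?CT.
  - by rewrite unitmxZ // unitfE gt_eqF ?expR_gt0.
  - by rewrite -scalemxAl -scalemxAr scalerA -expRD; congr (expR _ *: _); field.
  - rewrite -!scalemxAl -scalemxAr scalerA -expRD scalemxAl scalemxAr.
    congr (_ *m _ *m _); apply/matrixP=> i j; rewrite !mxE mulrnAr -expRD.
    by congr (expR _ *+ _); field.
rewrite ler_expR -(@ler_pXn2r _ 2) ?nnegrE ?mulr_ge0 ?sqrtr_ge0 // exprMn.
have [N1|N1] := ltnP 1 N; last first.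
  have N41 : (N ^ 2 %/ 4 = 0)%N.
    by have -> : N = 1%N by apply/eqP; rewrite eqn_leq N1.
  by rewrite N41 invr0 mulr0 sqrtr0 expr0n mul0r sqr_ge0.
have B0 : 0 < (N ^ 2 %/ 4)%:R :> R.
  by rewrite ltr0n divn_gt0 // (leq_trans _ (leq_mul N1 N1)).
rewrite !sqr_sqrtr ?le_max ?lexx ?orbT ?divr_ge0 ?ler0n //.
rewrite mulrAC ler_pdivrMr // [leRHS]mulrC; apply: le_trans sp.
rewrite ler_wpM2l ?ler0n // ge_max; apply/andP; split; last first.
  by apply: sumr_ge0 => i _; exact: sqr_ge0.
apply: le_trans (hr (expR mu) (expR_gt0 _)) _; rewrite (dAI_sqr scaled).
by apply: ler_sum => i _; rewrite !mxE.
Qed.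

End Certificates.

Theorem corollary5p22 (R : realType) (m n : nat) (hmn : (2 <= m * n)%N)
    (K : R) (hK : 1 <= K)
    (H : 'M[R]_(n * m)) (hH : spd H)
    (G : 'M[R]_(n * m)) (hG : kron_family m n G)
    (rho_lo eta_hi kappa_lo kappa_hi : R) :
  let rho := dAI H G in
  let eta := frob (tangent_proj (mxlog (whiten G H))) in
  let kappaG := gen_cond G H in
  let alpha := Num.sqrt ((m * n)%:R / ((m * n) ^ 2 %/ 4)%:R) : R in
  let delta_lo := Num.sqrt (Num.max (rho_lo ^+ 2 - eta_hi ^+ 2) 0) in
  0 <= rho_lo <= rho ->
  0 <= eta <= eta_hi ->
  1 <= kappa_lo -> kappa_lo <= kappaG <= kappa_hi ->
  [/\ K < expR (alpha * delta_lo) -> kron_target K H = set0,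
      kappa_hi <= K -> kron_target K H G,
      expR (2 * eta_hi) * kappa_hi <= K -> kron_target K H (kron_proj H) &
      K < expR (- (2 * eta_hi)) * kappa_lo ->
        ~ kron_target K H (kron_proj H)]
  /\ (let exact := exact_test K alpha delta_lo eta_hi kappa_lo kappa_hi in
      let logdom := log_test K alpha delta_lo eta_hi kappa_lo kappa_hi in
      (forall t, exact t = logdom t) /\
      forall reports : test -> bool,
        (forall t, reports t -> exact t) ->
        [/\ forall t, reports t -> claim K H G t,
            output_claim K H G (procedure reports) &
            (forall t, ~~ reports t) -> procedure reports = INCONCLUSIVE]).
Proof.
move=> rho eta kappaG alpha delta_lo /andP[rho_lo0 rho_loP] /andP[eta0 etaP].
move=> kappa_lo1 /andP[kappa_loP kappa_hiP].
have [m0 n0] : (0 < m)%N /\ (0 < n)%N.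
  by apply/andP; rewrite -muln_gt0; exact: leq_trans hmn.
have N0 : (0 < n * m)%N by rewrite muln_gt0 n0.
have Gs := kron_spd hG; have [Pk _] := kron_projP m0 n0 hH; have Ps := kron_spd Pk.
have dGP : dAI G (kron_proj H) <= eta_hi := le_trans (dAI_kron_proj_le m0 n0 hG hH) etaP.
have dPG : dAI (kron_proj H) G <= eta_hi by rewrite (dAI_sym Ps Gs).
have sound : [/\ K < expR (alpha * delta_lo) -> kron_target K H = set0,
      kappa_hi <= K -> kron_target K H G,
      expR (2 * eta_hi) * kappa_hi <= K -> kron_target K H (kron_proj H) &
      K < expR (- (2 * eta_hi)) * kappa_lo ->
        ~ kron_target K H (kron_proj H)].
  split.
  - move=> KP; apply/seteqP; split=> // G' [Gk' G'K].
    suff : expR (alpha * delta_lo) <= K by rewrite leNgt KP.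
    apply: le_trans G'K; apply: gen_cond_ge_dist => // c c0.
    apply: le_trans (dAI_family_ge m0 n0 hG (kron_scale c0 Gk') hH).
    by rewrite lerB // ler_pXn2r ?nnegrE ?dAI_ge0 // (le_trans eta0).
  - by move=> hiK; split=> //; exact: le_trans kappa_hiP hiK.
  - move=> hiK; split=> //; apply: le_trans hiK.
    apply: le_trans (gen_cond_le N0 Gs Ps hH dGP) _.
    by rewrite ler_pM2l ?expR_gt0.
  - move=> loK [_]; apply/negP; rewrite -ltNge; apply: lt_le_trans loK _.
    rewrite expRN mulrC ler_pdivrMr ?expR_gt0 // mulrC.
    exact: le_trans kappa_loP (gen_cond_le N0 Ps Gs hH dPG).
split=> //; split=> [t|reports rep].
  have K0 : 0 < K by exact: lt_le_trans hK.
  have lo0 : 0 < kappa_lo by exact: lt_le_trans kappa_lo1.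
  have hi0 : 0 < kappa_hi by rewrite (lt_le_trans lo0) // (le_trans kappa_loP).
  case: t => /=.
  - by rewrite -[in LHS](lnK K0) ltr_expR.
  - by rewrite ler_ln.
  - by rewrite -[in LHS](lnK hi0) -expRD -[in LHS](lnK K0) ler_expR.
  - by rewrite -[in LHS](lnK lo0) -expRD -[in LHS](lnK K0) ltr_expR.
have cl t : reports t -> claim K H G t.
  by case: sound => s1 s2 s3 s4; case: t => /rep.
split=> //.
- by rewrite /procedure; case: ifP.
- by move=> none; rewrite /procedure !(negbTE (none _)).
Qed.
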